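(* Assume $0<\lambda_1<1<\lambda_2$ are such that $\lambda_1\lambda_2<\frac14$. Then there exists a smooth ($C^\infty$), bounded function $\phi:\mathbb{R}\to\mathbb{R}$ such that $h(\epsilon):=\int_{\mathbb{R}}\phi\,d\mu_{\lambda_1+\epsilon,\lambda_2}$ (defined for $|\epsilon|$ small) is not differentiable at $\epsilon=0$.
   Context: Fix $d_1,d_2\in\mathbb{R}$ such that the maps $x\mapsto\lambda_1x+d_1$ and $x\mapsto\lambda_2x+d_2$ do not have the same fixed point, i.e. $\frac{d_1}{1-\lambda_1}\ne\frac{d_2}{1-\lambda_2}$. For $0<a<1<b$ with $ab<1$, $\mu_{a,b}$ denotes the unique stationary measure of the iterated function system $x\mapsto ax+d_1$, $x\mapsto bx+d_2$ with probabilities $(\frac12,\frac12)$, i.e. the unique Borel probability measure $\mu$ on $\mathbb{R}$ equal to $\frac12$ of its push-forward by the first map plus $\frac12$ of its push-forward by the second map. *)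

(* Defs.v *)
From HB Require Import structures.
From mathcomp Require Import all_boot all_order all_algebra.
From mathcomp Require Import all_classical all_reals all_analysis.
Import Order.TTheory GRing.Theory Num.Theory.
Import numFieldNormedType.Exports.

Set Implicit Arguments.
Unset Strict Implicit.
Unset Printing Implicit Defensive.

Local Open Scope classical_set_scope.
Local Open Scope ring_scope.

Definition affine (R : realType) (a d : R) : measurableTypeR R -> measurableTypeR R :=
  fun x : R => a * x + d.

(* Mathcomp measures are total functions on sets, so equality of measures is
   only imposed on Borel sets. *)
Definition stationary (R : realType) (d1 d2 a b : R)
    (mu : probability (measurableTypeR R) R) : Prop :=
  forall A : set (measurableTypeR R), measurable A ->
    mu A = ((2^-1)%:E * pushforward mu (affine a d1) A
          + (2^-1)%:E * pushforward mu (affine b d2) A)%E.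

(* The measure mu_{a,b}. When 0 < a < 1 < b and a * b < 1 the stationary
   measure exists and is unique (on Borel sets), so the choice made by [xget]
   is irrelevant there; the Dirac mass is a default value for parameters that
   admit no stationary measure. *)
Definition stationary_measure (R : realType) (d1 d2 a b : R) :
    probability (measurableTypeR R) R :=
  xget (@dirac _ (measurableTypeR R) (0 : R) R : probability (measurableTypeR R) R)
       [set mu | stationary d1 d2 a b mu].

Definition smooth (R : realType) (f : R -> R) : Prop :=
  forall (n : nat) (x : R), derivable (f^`(n))%classic x 1.

(* Main.v *)
(* For [x] close to [l1], the stationary measure is the law of a random variable
   X_x = p + k(x) G_x, where p is the fixed point of the second map and G_x is a
   random power series in x with non-negative coefficients, driven by fair coin
   flips.  Since [l1 * l2 < 1/4], the 2^n cylinders of length n typically have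
   diameter r^n with r < 1/2: the law of X_{l1} is carried, up to a small mass,
   by 2^n intervals of length about r^n.  On a suitable cylinder event A, of
   positive probability and on which X_x is as far away as desired, x |-> X_x is
   expanding.  Hence on A, along a grid of mesh about r^n, each interval catches
   at most one grid value, so for most grid points x the variable X_x avoids the
   intervals on A: as (2r)^n -> 0, the integral of a smooth function that is
   supported far away and close to 1 on the intervals jumps by a fixed amount c
   between [l1] and parameters x arbitrarily close to it.  Summing such functions
   with supports going to infinity (gliding hump), with x so close to [l1] that
   |x - l1| is negligible compared to c, destroys the differentiability. *)

Require Import Defs.
From HB Require Import structures.
From mathcomp Require Import all_boot all_order all_algebra.
From mathcomp Require Import all_classical all_reals all_analysis.
From mathcomp Require Import measurable_realfun.
From mathcomp Require Import ring lra.
Set Implicit Arguments.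
Unset Strict Implicit.
Unset Printing Implicit Defensive.

Import Order.TTheory GRing.Theory Num.Theory.
Import numFieldNormedType.Exports.

Local Open Scope classical_set_scope.
Local Open Scope ring_scope.

(** * Smooth functions *)

(** The expanding map rules out working with means: the stationary variable may have no first
    moment. Sizes are therefore measured by moments of a small order s. For positive u, v with u v <
    1, the function s |-> u^s + v^s equals 2 at 0 and has slope ln(u v) < 0 there, so (u^s + v^s) /
    2 < 1 for some s. Applied to the two slopes this gives almost sure convergence; applied to the
    slopes divided by r it gives the cylinder estimate, which needs l1 l2 < r^2 and so allows r <
    1/2 because l1 l2 < 1/4.

    All parameters in [l1, z], where l1 < z < 1/l2, live on one coin space and off one null set,
    since domination at z covers every smaller parameter. Only x >= l1 is compared with l1, which
    suffices against differentiability.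

    Expansion is not automatic, as |k| may shrink while G grows. A long run of the first map makes
    the logarithmic derivative of G beat that of k; distinct fixed points mean k(l1) != 0.

    The size c of a jump depends on how far away the hump sits and has no uniform lower bound. It
    does not depend on how close x is to l1, and this order of quantifiers is what the gliding hump
    requires. *)

Section Smooth.
Variable R : realType.
Implicit Types (f g : R -> R) (n : nat).

(** Smoothness up to order n, peeling off the innermost derivative, so that the product and chain
    rules pass to all orders by induction on n. *)
Fixpoint diffn n f : Prop :=
  if n is n'.+1 then (forall x, derivable f x 1) /\ diffn n' (derive1 f)
  else True.

Lemma diffn_smooth f : (forall n, diffn n f) -> smooth f.
Proof.
move=> H n; elim: n f H => [|n IH] f H x; first exact: (H 1%N).1.
by rewrite derive1Sn; apply: IH => k; exact: (H k.+1).2.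
Qed.

Lemma smooth_diffn n f : smooth f -> diffn n f.
Proof.
elim: n f => [//|n IH] f H; split; first exact: (H 0%N).
by apply: IH => k x; rewrite -derive1Sn; exact: H.
Qed.

Lemma diffnS_is_derive n f g :
  (forall x : R, is_derive x (1 : R) f (g x)) -> diffn n g -> diffn n.+1 f.
Proof.
move=> fg gn; split; first by move=> x; have [] := fg x.
suff -> : (derive1 f) = g by [].
by apply/funext => x; rewrite derive1E; have [_ ->] := fg x.
Qed.

Lemma diffnW n f : diffn n.+1 f -> diffn n f.
Proof. by elim: n f => [//|n IH] f [d H]; split => //; exact: IH. Qed.

Lemma diffn_is_derive n f : diffn n.+1 f ->
  forall x : R, is_derive x (1 : R) f (derive1 f x).
Proof. by move=> [d _] x; apply: DeriveDef => //; rewrite derive1E. Qed.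

Lemma diffn_cst n (c : R) : diffn n (fun=> c).
Proof.
elim: n c => [//|n IH] c; exact: (@diffnS_is_derive _ _ (fun=> 0)).
Qed.

Lemma diffnD n f g : diffn n f -> diffn n g -> diffn n (fun x => f x + g x).
Proof.
elim: n f g => [//|n IH] f g Hf Hg.
apply: (@diffnS_is_derive _ _ (fun x => derive1 f x + derive1 g x)).
  by move=> x; apply: is_deriveD; exact: (@diffn_is_derive n).
by apply: IH; [case: Hf|case: Hg].
Qed.

Lemma diffnM n f g : diffn n f -> diffn n g -> diffn n (fun x => f x * g x).
Proof.
elim: n f g => [//|n IH] f g Hf Hg.
apply: (@diffnS_is_derive _ _ (fun x => f x * derive1 g x + g x * derive1 f x)).
  by move=> x; apply: is_deriveM; exact: (@diffn_is_derive n).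
by apply: diffnD; apply: IH; by [exact: diffnW|case: Hf|case: Hg].
Qed.

Lemma diffn_id n : diffn n (fun x : R => x).
Proof.
case: n => [//|n]; apply: (@diffnS_is_derive _ _ (fun=> 1)).
exact: diffn_cst.
Qed.

Lemma diffn_comp n f g : diffn n f -> diffn n g -> diffn n (fun x => f (g x)).
Proof.
elim: n f g => [//|n IH] f g Hf Hg.
apply: (@diffnS_is_derive _ _ (fun x => derive1 f (g x) * derive1 g x)).
  move=> x; apply: (@is_derive1_comp _ f g x).
  - exact: (@diffn_is_derive n).
  - exact: (@diffn_is_derive n).
by apply: diffnM; [apply: IH; [case: Hf|exact: diffnW]|case: Hg].
Qed.

Lemma smooth_cst (c : R) : smooth (fun=> c : R).
Proof. by apply: diffn_smooth => n; exact: diffn_cst. Qed.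

Lemma smooth_id : smooth (fun x : R => x).
Proof. by apply: diffn_smooth => n; exact: diffn_id. Qed.

Lemma smoothD f g : smooth f -> smooth g -> smooth (fun x => f x + g x).
Proof.
by move=> sf sg; apply: diffn_smooth => n; apply: diffnD; exact: smooth_diffn.
Qed.

Lemma smoothM f g : smooth f -> smooth g -> smooth (fun x => f x * g x).
Proof.
by move=> sf sg; apply: diffn_smooth => n; apply: diffnM; exact: smooth_diffn.
Qed.

Lemma smoothB f g : smooth f -> smooth g -> smooth (fun x => f x - g x).
Proof.
move=> sf sg; under eq_fun do rewrite -mulN1r.
apply: smoothD; first exact: sf.
by apply: smoothM; [exact: smooth_cst|exact: sg].
Qed.

Lemma smooth_comp f g : smooth f -> smooth g -> smooth (fun x => f (g x)).
Proof.
by move=> sf sg; apply: diffn_smooth => n; apply: diffn_comp; exact: smooth_diffn.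
Qed.

Lemma smooth_sum (I : Type) (r : seq I) (F : I -> R -> R) :
  (forall i, smooth (F i)) -> smooth (fun x => \sum_(i <- r) F i x).
Proof.
move=> sF; elim: r => [|i r IH].
  by under eq_fun do rewrite big_nil; exact: smooth_cst.
rewrite (_ : (fun x => _) = fun x => F i x + \sum_(j <- r) F j x).
  exact: (smoothD (sF i) IH).
by apply/funext => x; rewrite big_cons.
Qed.

Lemma smooth_continuous f : smooth f -> continuous f.
Proof.
by move=> sf x; apply: differentiable_continuous; apply/derivable1_diffP;
  exact: (sf 0%N).
Qed.

Lemma derive1n_near_eq n f g (U : set R) : open U ->
  {in U, f =1 g} -> {in U, derive1n n f =1 derive1n n g}.
Proof.
move=> oU fg; elim: n => [//|n IH] x xU.
rewrite !derive1nS !derive1E; apply: near_eq_derive.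
near=> y; apply: IH; rewrite inE; near: y.
by apply: open_nbhs_nbhs; split => //; move: xU; rewrite inE.
Unshelve. all: by end_near. Qed.

(** Smoothness is local; this is what makes a locally finite infinite sum of humps smooth. *)
Lemma smooth_locally f :
  (forall x, exists g (U : set R), [/\ open U, U x, smooth g & {in U, f =1 g}]) ->
  smooth f.
Proof.
move=> H n x; have [g [U [oU Ux sg fg]]] := H x.
apply: (near_eq_derivable (f := derive1n n g)); last exact: sg.
near=> y; apply/esym; apply: (derive1n_near_eq n oU fg).
rewrite inE; near: y; exact: open_nbhs_nbhs.
Unshelve. all: by end_near. Qed.

End Smooth.

(** * A smooth function that vanishes exactly on the non-positive half-line *)

Section Flat.
Variable R : realType.

(** The difference quotient at 0 is at most C |h|. This handles the gluing point of [flat], where no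
    formula can be differentiated. *)
Lemma is_derive0_quadratic (f : R -> R) (C : R) :
  (forall h, `|f h| <= C * h ^+ 2) -> is_derive (0 : R) (1 : R) f 0.
Proof.
move=> fC.
have f0 : f 0 = 0.
  by apply/eqP; rewrite -normr_eq0 eq_le normr_ge0 (le_trans (fC 0))// expr0n mulr0.
have H : (fun h : R => h^-1 *: ((f \o shift (0 : R)) (h *: (1 : R)) - f 0)) @ (0 : R)^' --> (0 : R).
  apply/cvgr0Pnorm_le => e e0.
  have C0 : 0 <= C.
    by have := fC 1; rewrite expr1n mulr1; apply: le_trans; exact: normr_ge0.
  have C1 : 0 < e / (C + 1) by rewrite divr_gt0// ltr_wpDl.
  near=> h.
  have h0 : h != 0 by near: h; exact: nbhs_dnbhs_neq.
  rewrite /= f0 subr0 addr0 /GRing.scale/= mulr1 normrM normfV.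
  rewrite ler_pdivrMl ?normr_gt0//.
  apply: le_trans (fC h) _.
  rewrite -real_normK ?num_real// expr2 mulrCA ler_wpM2l//.
  have hC : `|h| <= e / (C + 1).
    by near: h; exact: dnbhs0_le.
  rewrite ler_pdivlMr in hC; last by rewrite ltr_wpDl.
  rewrite mulrDr mulr1 in hC; rewrite mulrC; apply: le_trans hC.
  by rewrite lerDl.
apply: DeriveDef; first by apply/cvg_ex; exists 0.
by apply: cvg_lim.
Unshelve. all: by end_near. Qed.

(* The powers of 1/x make the family stable under differentiation. *)
Definition flat (n : nat) (x : R) : R :=
  if 0 < x then x^-1 ^+ n * expR (- x^-1) else 0.

(** For x > 0 a single term of the exponential series suffices: exp(1/x) >= x^-(n+2) / (n+2)!. *)
Lemma flat_quadratic n (x : R) : `|flat n x| <= (n.+2)`!%:R * x ^+ 2.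
Proof.
rewrite /flat; case: ifPn => x0; last by rewrite normr0 mulr_ge0// sqr_ge0.
rewrite ger0_norm; last by rewrite mulr_ge0// ?expR_ge0// exprn_ge0// invr_ge0 ltW.
rewrite expRN ler_pdivrMr ?expR_gt0//.
have x10 : 0 <= x^-1 by rewrite invr_ge0 ltW.
have E := expR_ge1Dxn n.+1 x10.
have {}E : x^-1 ^+ n.+2 / n.+2`!%:R <= expR x^-1.
  by apply: le_trans (E); rewrite lerDr.
rewrite ler_pdivrMr ?ltr0n ?fact_gt0// in E.
have -> : x^-1 ^+ n = x ^+ 2 * x^-1 ^+ n.+2.
  by rewrite -[n.+2]/(2 + n)%N exprD mulrA -exprMn divff ?gt_eqF// expr1n mul1r.
by rewrite [leRHS]mulrAC [leRHS]mulrC ler_wpM2l ?sqr_ge0// mulrC.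
Qed.

Lemma is_derive_flat n (x : R) :
  is_derive (x : R) (1 : R) (flat n) (flat n.+2 x - n%:R * flat n.+1 x).
Proof.
have [x0|x0|->] := ltgtP x 0.
- have -> : flat n.+2 x - n%:R * flat n.+1 x = 0.
    by rewrite /flat ltNge (ltW x0) /= mulr0 subr0.
  apply: (@near_eq_is_derive _ _ _ (fun=> 0 : R)).
  near=> y; rewrite /flat ifF//; apply/negbTE; rewrite -leNgt ltW//.
  near: y; exact: lt_nbhsl.
- have dx : is_derive (x : R) (1 : R) (fun y : R => y^-1) (- x ^- 2).
    apply: is_derive_eq; first exact: (@is_deriveV R id x 1 1 (lt0r_neq0 x0) (is_derive_id _ _)).
    by rewrite /GRing.scale/= mulr1.
  apply: (@near_eq_is_derive _ _ _ (fun y : R => y^-1 ^+ n * expR (- y^-1))).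
    near=> y; rewrite /flat ifT//; near: y; exact: lt_nbhsr.
  have dn : is_derive (x : R) (1 : R) (fun y : R => y^-1 ^+ n)
      (n%:R * x^-1 ^+ n.-1 * - x ^- 2).
    by have := is_deriveX n dx; rewrite exprfctE.
  have de : is_derive (x : R) (1 : R) (fun y : R => expR (- y^-1))
      (expR (- x^-1) * x ^- 2).
    rewrite -[x ^- 2]opprK.
    exact: (@is_derive1_comp _ expR (fun y : R => - y^-1)).
  apply: is_derive_eq (is_deriveM dn de) _.
  rewrite /flat x0 /GRing.scale/= -exprVn.
  by case: n {dn} => [|n] /=; rewrite ?expr0 ?mulr0n ?exprS; ring.
- have -> : flat n.+2 0 - n%:R * flat n.+1 0 = 0.
    by rewrite /flat ltxx mulr0 subr0.
  exact: is_derive0_quadratic (flat_quadratic n).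
Unshelve. all: by end_near. Qed.

Lemma smooth_flat n : smooth (flat n).
Proof.
apply: diffn_smooth => k; elim: k n => [//|k IH] n.
apply: (diffnS_is_derive (is_derive_flat n)).
apply: diffnD; first exact: IH.
under eq_fun do rewrite -mulNr.
by apply: diffnM; [exact: diffn_cst|exact: IH].
Qed.

Lemma flat_ge0 (x : R) : 0 <= flat 0 x.
Proof. by rewrite /flat; case: ifP => // _; rewrite expr0 mul1r expR_ge0. Qed.

Lemma flat_gt0 (x : R) : 0 < x -> 0 < flat 0 x.
Proof. by rewrite /flat => ->; rewrite expr0 mul1r expR_gt0. Qed.

Lemma flat_le1 (x : R) : flat 0 x <= 1.
Proof.
rewrite /flat; case: ifP => // x0; rewrite expr0 mul1r expR_le1 oppr_le0.
by rewrite invr_ge0 ltW.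
Qed.

Lemma flat_eq0 (x : R) : x <= 0 -> flat 0 x = 0.
Proof. by rewrite /flat ltNge => ->. Qed.

Lemma le_flat (x y : R) : x <= y -> flat 0 x <= flat 0 y.
Proof.
have [x0|x0] := leP x 0; first by rewrite (flat_eq0 x0) flat_ge0.
move=> xy; rewrite /flat x0 (lt_le_trans x0 xy) !expr0 !mul1r ler_expR lerN2.
by rewrite lef_pV2// posrE// (lt_le_trans x0).
Qed.

(** At y = 1/d the value is exp(-d) >= 1 - d. *)
Lemma flat_near1 (d : R) : 0 < d -> exists2 y, 0 < y & 1 - d <= flat 0 y.
Proof.
move=> d0; exists d^-1; first by rewrite invr_gt0.
rewrite /flat invr_gt0 d0 expr0 mul1r invrK.
exact: (expR_ge1Dx (- d)).
Qed.

End Flat.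

(** * Fair coin flips on the unit interval *)

(* Under P, the digit i is a fair coin flip independent of tau, and tau has law
   P: this is all that is used of the one-sided Bernoulli shift. *)
Definition coin_shift d (T : measurableType d) (R : realType)
    (P : probability T R) (i : T -> bool) (tau : T -> T) : Prop :=
  forall F0 F1 : T -> \bar R,
  measurable_fun setT F0 -> measurable_fun setT F1 ->
  (forall w, 0 <= F0 w)%E -> (forall w, 0 <= F1 w)%E ->
  (\int[P]_w (if i w then F1 (tau w) else F0 (tau w)) =
   (2^-1)%:E * (\int[P]_w F0 w + \int[P]_w F1 w))%E.

Section Coin.
Variable R : realType.
Local Notation lam := (@lebesgue_measure R).

Definition dbl (c : R) : measurableTypeR R -> measurableTypeR R :=
  fun t : R => 2 * t - c.

Lemma measurable_dbl c : measurable_fun setT (dbl c).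
Proof. by apply: measurable_funB => //; exact: measurable_funM. Qed.

(** Twice the pushforward gives half-open intervals their length, so it is Lebesgue measure by
    uniqueness. *)
Lemma lebesgue_measure_dbl (c : R) (A : set (measurableTypeR R)) :
  measurable A -> pushforward lam (dbl c) A = ((2^-1)%:E * lam A)%E.
Proof.
move=> mA.
have -> : lam A = pushforward (mscale (NngNum (ler0n R 2)) lam) (dbl c) A.
  apply: lebesgue_measure_unique => //=; first exact: measurable_dbl.
  move=> mF _ [[u v]] _ <-.
  rewrite /pushforward /mscale/=.
  have -> : dbl c @^-1` `]u, v]%classic = `](u + c) / 2, (v + c) / 2]%classic.
    apply/seteqP; split => t /=; rewrite !in_itv /dbl /=; lra.
  rewrite !lebesgue_measure_itv/= !lte_fin ltr_pM2r// ltrD2r.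
  case: ifP => // _; last by rewrite mule0.
  by rewrite -!EFinB -EFinM; congr EFin; field.
by rewrite /pushforward /mscale/= muleA -EFinM mulVf// mul1e.
Qed.

Lemma ge0_integral_dbl (c : R) (D : set (measurableTypeR R)) (F : R -> \bar R) :
  measurable D -> measurable_fun setT F -> (forall t, 0 <= F t)%E ->
  (\int[lam]_(t in dbl c @^-1` D) F (dbl c t) =
   (2^-1)%:E * \int[lam]_(t in D) F t)%E.
Proof.
move=> mD mF F0.
have h0 : 0 <= 2^-1 :> R by rewrite invr_ge0 ler0n.
have mFD : measurable_fun D F by exact: measurable_funTS.
rewrite -(ge0_integral_pushforward (measurable_dbl c) lam mD mFD)//.
rewrite (@eq_measure_integral _ _ _ _
  (mscale (NngNum h0) lam)).
  by rewrite ge0_integral_mscale.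
  exact: measurable_dbl.
by move=> mdbl A mA _; exact: lebesgue_measure_dbl.
Qed.

(* The Lebesgue measure on [0, 1] with the first binary digit and the doubling
   map as shift. *)
Definition coin : probability (measurableTypeR R) R := uniform_prob (@ltr01 R).
Definition digit : measurableTypeR R -> bool := fun t : R => 2^-1 <= t.
Definition shft : measurableTypeR R -> measurableTypeR R :=
  fun t => dbl (if digit t then 1 else 0) t.

Lemma measurable_digit : measurable_fun setT digit.
Proof. exact: measurable_fun_ler. Qed.

Lemma measurable_shft : measurable_fun setT shft.
Proof.
rewrite (_ : shft = fun t => if digit t then dbl 1 t else dbl 0 t).
  apply: measurable_fun_ifT; [exact: measurable_digit|exact: measurable_dbl..].
by apply/funext => t; rewrite /shft; case: ifP.
Qed.

(** Cut [0, 1] at 1/2: on each half the shift is affine onto the unit interval, up to an endpoint,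
    and the change of variables produces the factor 1/2. *)
Lemma coin_shift_coin : coin_shift coin digit shft.
Proof.
move=> F0 F1 mF0 mF1 p0 p1.
have mS := measurable_shft.
have mF : measurable_fun setT
    (fun t => if digit t then F1 (shft t) else F0 (shft t)).
  apply: measurable_fun_ifT; first exact: measurable_digit.
  - exact: (measurableT_comp mF1).
  - exact: (measurableT_comp mF0).
rewrite /coin !integral_uniform//; last by move=> t; case: ifP.
rewrite subr0 invr1 !mul1e.
rewrite (_ : `[0, 1]%classic = `[0, 2^-1[ `|` `[2^-1, 1]); last first.
  by apply/seteqP; split => t /=; rewrite !in_itv/=; lra.
rewrite [LHS]ge0_integral_setU//=; last 3 first.
- exact: measurable_funTS.
- by move=> t _; case: ifP.
- apply/disj_set2P; rewrite -subset0 => t /=; rewrite !in_itv/=; lra.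
rewrite (_ : `[0, 2^-1[ `|` `[2^-1, 1] = `[0, 1]%classic :> set R); last first.
  by apply/seteqP; split => t /=; rewrite !in_itv/=; lra.
rewrite ge0_muleDr ?integral_ge0//; congr (_ + _)%E.
- rewrite -(@integral_itv_bndo_bndc _ (BLeft 0) 1 F0); last exact: measurable_funTS.
  rewrite -(@ge0_integral_dbl 0)//.
  rewrite (_ : dbl 0 @^-1` _ = `[0, 2^-1[%classic); last first.
    by apply/seteqP; split => t /=; rewrite !in_itv/= /dbl; lra.
  apply: eq_integral => t; rewrite inE/= in_itv/= /shft /digit => /andP[_ t1].
  by rewrite leNgt t1.
- rewrite -(@ge0_integral_dbl 1)//.
  rewrite (_ : dbl 1 @^-1` _ = `[2^-1, 1]%classic); last first.
    by apply/seteqP; split => t /=; rewrite !in_itv/= /dbl; lra.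
  apply: eq_integral => t; rewrite inE/= in_itv/= /shft /digit => /andP[t1 _].
  by rewrite t1.
Qed.

End Coin.

(** * Perpetuities *)

(** Write (1 + y)^s = (1 + y)^(s-1) + y (1 + y)^(s-1) and use that t |-> t^(s-1) is
    nonincreasing. *)
Lemma ler_powRD1 (R : realType) (s y : R) : 0 < s <= 1 -> 0 <= y ->
  (1 + y) `^ s <= 1 + y `^ s.
Proof.
move=> /andP[s0 s1] y0; have [->|yN0] := eqVneq y 0.
  by rewrite addr0 powR1 lerDl powR_ge0.
have y1 : 0 < 1 + y by rewrite ltr_wpDr.
rewrite -(@mulr_powRB1 _ (1 + y) s (ltW y1) s0) mulrDl mul1r.
have decr (u v : R) : 0 < u -> u <= v -> v `^ (s - 1) <= u `^ (s - 1).
  move=> u0 uv; rewrite -(opprB 1 s) 2!powRN lef_pV2 ?posrE ?powR_gt0//.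
    by apply: ge0_ler_powR => //; rewrite ?nnegrE ?subr_ge0// ltW// (lt_le_trans u0).
  exact: lt_le_trans uv.
apply: lerD.
  by have := decr 1 (1 + y) ltr01; rewrite powR1; apply; rewrite lerDl.
rewrite -(@mulr_powRB1 _ y s y0 s0) ler_wpM2l// decr//; first by rewrite lt0r yN0.
by rewrite lerDr.
Qed.

(** The sum is 2 at s = 0 and its derivative there is ln(u v) < 0. Every bound on a product of
    slopes enters the probabilistic estimates through this lemma. *)
Lemma powR_sum_lt2 (R : realType) (u v : R) : 0 < u -> 0 < v -> u * v < 1 ->
  exists2 s, 0 < s <= 1 & u `^ s + v `^ s < 2.
Proof.
move=> u0 v0 uv1.
have e0 : ln u + ln v < 0 by rewrite -lnM ?posrE// ln_lt0// mulr_gt0.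
have d (x : R) : is_derive (0 : R) (1 : R) (fun s : R => expR (s * x)) x.
  have dx : is_derive (0 : R) (1 : R) (fun s : R => s * x) x.
    have h := @is_deriveM R R id (cst x) 0 1 1 0 (is_derive_id _ _)
      (is_derive_cst _ _ _).
    by apply: is_derive_eq h _; rewrite scaler0 add0r /GRing.scale/= mulr1.
  apply: is_derive_eq (@is_derive1_comp _ expR (fun s => s * x) _ _ _ _ dx) _.
  by rewrite mul0r expR0 mul1r.
pose f := fun s : R => expR (s * ln u) + expR (s * ln v).
have [df Df] : is_derive (0 : R) (1 : R) f (ln u + ln v).
  exact: is_deriveD (d (ln u)) (d (ln v)).
have f0 : f 0 = 2 by rewrite /f/= !mul0r !expR0.
have : (fun h : R => h^-1 *: ((f \o shift (0 : R)) (h *: (1 : R)) - f 0)) @ (0 : R)^'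
    --> ln u + ln v by rewrite -Df.
move=> /cvgr_lt /(_ _ e0)/= H.
have [e /= e_gt0 He] := H.
pose s := Num.min (e / 2) 1.
have s0 : 0 < s by rewrite lt_min divr_gt0//=.
have se : s < e.
  by rewrite gt_min ltr_pdivrMr// ltr_pMr// ltr1n.
have := He s; rewrite /= /ball/= sub0r normrN gtr0_norm// => /(_ se (lt0r_neq0 s0)).
rewrite /GRing.scale/= mulr1 addr0 f0 pmulr_rlt0 ?invr_gt0// subr_lt0 => fs.
exists s; first by rewrite s0 ge_min lexx orbT.
by rewrite /powR !gt_eqF.
Qed.

Section Walk.
Context d (T : measurableType d) (R : realType) (P : probability T R).
Variables (i : T -> bool) (tau : T -> T).
Hypotheses (mi : measurable_fun setT i) (mtau : measurable_fun setT tau).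
Hypothesis coinP : coin_shift P i tau.
Variable b : R.
Hypothesis b0 : 0 < b.
Implicit Types (x : R) (n : nat) (w : T).

(* Partial sums of the perpetuity attached to the normalised maps t |-> x t + 1
   (digit false) and t |-> b t (digit true). *)
Fixpoint perp x n w : R :=
  if n is n'.+1 then
    if i w then b * perp x n' (tau w) else 1 + x * perp x n' (tau w)
  else 0.

(* Both offsets are 1: this dominates [perp], and the increments
   [dom x n.+1 w - dom x n w] are the products of the first n slopes. *)
Fixpoint dom x n w : R :=
  if n is n'.+1 then 1 + (if i w then b else x) * dom x n' (tau w) else 0.

Lemma measurable_perp x n : measurable_fun setT (perp x n).
Proof.
elim: n => [|n IH] /=; first exact: measurable_cst.
have mn : measurable_fun setT (perp x n \o tau) by exact: measurableT_comp.
apply: measurable_fun_ifT => //; first exact: measurable_funM.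
by apply: measurable_funD => //; exact: measurable_funM.
Qed.

Lemma measurable_dom x n : measurable_fun setT (dom x n).
Proof.
elim: n => [|n IH] /=; first exact: measurable_cst.
have mn : measurable_fun setT (dom x n \o tau) by exact: measurableT_comp.
apply: measurable_funD => //; apply: measurable_funM => //.
exact: measurable_fun_ifT.
Qed.

Lemma perp_ge0 x n w : 0 <= x -> 0 <= perp x n w.
Proof.
move=> x0; elim: n w => [//|n IH] w /=; case: ifP => _.
  by rewrite mulr_ge0// ltW.
by rewrite addr_ge0// mulr_ge0.
Qed.

Lemma dom_ge0 x n w : 0 <= x -> 0 <= dom x n w.
Proof.
move=> x0; elim: n w => [//|n IH] w /=; rewrite addr_ge0// mulr_ge0//.
by case: ifP => // _; exact: ltW.
Qed.

Lemma perp_le_dom x n w : 0 <= x -> perp x n w <= dom x n w.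
Proof.
move=> x0; elim: n w => [//|n IH] w /=; case: ifP => _.
  by rewrite ler_wpDl// ler_wpM2l// ltW.
by rewrite lerD2l ler_wpM2l.
Qed.

Lemma perp_leS x n w : 0 <= x -> perp x n w <= perp x n.+1 w.
Proof.
move=> x0; elim: n w => [|n IH] w; first exact: perp_ge0.
rewrite [leLHS]/= [leRHS]/=; case: ifP => _; first by rewrite ler_wpM2l// ltW.
by rewrite lerD2l ler_wpM2l.
Qed.

Lemma dom_leS x n w : 0 <= x -> dom x n w <= dom x n.+1 w.
Proof.
move=> x0; elim: n w => [|n IH] w; first exact: dom_ge0.
rewrite [leLHS]/= [leRHS]/= lerD2l ler_wpM2l//.
by case: ifP => // _; exact: ltW.
Qed.

Lemma perp_mono x y n w : 0 <= x <= y -> perp x n w <= perp y n w.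
Proof.
move=> /andP[x0 xy]; elim: n w => [//|n IH] w /=; case: ifP => _.
  by rewrite ler_wpM2l// ltW.
by rewrite lerD2l ler_pM// perp_ge0.
Qed.

Lemma dom_mono x y n w : 0 <= x <= y -> dom x n w <= dom y n w.
Proof.
move=> /andP[x0 xy]; elim: n w => [//|n IH] w /=; rewrite lerD2l.
by case: ifP => _; [rewrite ler_wpM2l// ltW|rewrite ler_pM// dom_ge0].
Qed.

(** A polynomial with non-negative coefficients is convex on [0, z], so its slope on [x, y] is at
    most its slope on [y, z], itself at most [perp z n w] / (z - y). Clearing denominators lets the
    bound go through the recursion. *)
Lemma perp_lipschitz x y z n w : 0 <= x <= y -> y <= z ->
  (z - y) * (perp y n w - perp x n w) <= (y - x) * perp z n w.
Proof.
move=> /andP[x0 xy] yz; elim: n w => [|n IH] w /=; first by rewrite subr0 !mulr0.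
case: ifP => _.
  by rewrite -mulrBr mulrCA [leRHS]mulrCA ler_wpM2l// ltW.
have Pyz : perp y n (tau w) <= perp z n (tau w).
  by apply: perp_mono; rewrite yz (le_trans x0).
have := IH (tau w).
have := @perp_ge0 y n (tau w) (le_trans x0 xy).
move: (perp x n _) (perp y n _) (perp z n _) Pyz => u v t vt v0 H.
have H1 : x * ((z - y) * (v - u)) <= x * ((y - x) * t) by rewrite ler_wpM2l.
have H2 : (z - y) * (y - x) * v <= (z - y) * (y - x) * t.
  by rewrite ler_wpM2l// mulr_ge0 ?subr_ge0.
have H3 : 0 <= (y - x) * (y - x) * t.
  by rewrite !mulr_ge0 ?subr_ge0// (le_trans v0).
have H4 : 0 <= y - x by rewrite subr_ge0.
nra.
Qed.

(** Subadditivity of t^s and one coin flip give m(n+1) <= 1 + rho m(n) for the moments, with rho =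
    (x^s + b^s) / 2; the bound is the fixed point 1 / (1 - rho) of this recursion. *)
Lemma dom_moment x s n : 0 <= x -> 0 < s <= 1 -> x `^ s + b `^ s < 2 ->
  (\int[P]_w (dom x n w `^ s)%:E <= ((1 - (x `^ s + b `^ s) / 2)^-1)%:E)%E.
Proof.
move=> x0 s01 lt2; have /andP[s0 s1] := s01.
set rho := (x `^ s + b `^ s) / 2.
have rho1 : rho < 1 by rewrite /rho; lra.
have rho0 : 0 <= rho by rewrite divr_ge0// addr_ge0// powR_ge0.
elim: n => [|n IH].
  rewrite (eq_integral (fun=> 0%E)); last first.
    by move=> w _ /=; rewrite powR0// gt_eqF.
  by rewrite integral0 lee_fin invr_ge0 subr_ge0 ltW.
have mD : measurable_fun setT (fun w => (dom x n w `^ s)).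
  by apply: (measurableT_comp (measurable_powR s)); exact: measurable_dom.
pose F (c : R) w : \bar R := (1%:E + (c `^ s)%:E * (dom x n w `^ s)%:E)%E.
have F0 c w : (0 <= F c w)%E by rewrite /F -EFinM -EFinD lee_fin addr_ge0// mulr_ge0// powR_ge0.
have mF c : measurable_fun setT (F c).
  apply: emeasurable_funD => //; apply: emeasurable_funM => //.
  exact/measurable_EFinP.
have intF c : (\int[P]_w F c w = 1%:E + (c `^ s)%:E * \int[P]_w (dom x n w `^ s)%:E)%E.
  rewrite ge0_integralD//; last 2 first.
  - by move=> w _; rewrite -EFinM lee_fin mulr_ge0// powR_ge0.
  - by apply: emeasurable_funM => //; exact/measurable_EFinP.
  rewrite integral_cst//= probability_setT mule1 ge0_integralZl//.
  - exact/measurable_EFinP.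
  - by move=> w _; rewrite lee_fin powR_ge0.
  - by rewrite lee_fin powR_ge0.
apply: (@le_trans _ _ (\int[P]_w (if i w then F b (tau w) else F x (tau w)))%E).
  apply: ge0_le_integral => //.
  - by move=> w _; rewrite lee_fin powR_ge0.
  - apply/measurable_EFinP; apply: (measurableT_comp (measurable_powR s)).
    exact: measurable_dom.
  - by apply: measurable_fun_ifT => //; exact: measurableT_comp.
  move=> w _; rewrite /F /=.
  case: ifP => _; rewrite -EFinM -EFinD lee_fin -powRM ?dom_ge0// ?(ltW b0)//;
    apply: ler_powRD1 => //; rewrite mulr_ge0 ?dom_ge0// ltW//.
rewrite coinP// !intF.
have I0 : (0 <= \int[P]_w (dom x n w `^ s)%:E)%E.
  by apply: integral_ge0 => w _; rewrite lee_fin powR_ge0.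
have : (\int[P]_w (dom x n w `^ s)%:E \is a fin_num)%E.
  by rewrite ge0_fin_numE// (le_lt_trans IH)// ltry.
move: IH; case: (\int[P]_w _)%E I0 => // r r0 IH _.
rewrite -!EFinM lee_fin.
rewrite !lee_fin in r0 IH.
have e : 2^-1 * (1 + x `^ s * r + (1 + b `^ s * r)) = 1 + rho * r.
  by rewrite /rho; field.
rewrite e.
have -> : (1 - rho)^-1 = 1 + rho * (1 - rho)^-1.
  by field; rewrite subr_eq0 gt_eqF.
by rewrite lerD2l ler_wpM2l.
Qed.

(** The event on which the dominating series converges. Integer bounds keep it a countable union,
    hence measurable. *)
Definition good x : set T := [set w | exists K : nat, forall n, dom x n w <= K%:R].

Lemma measurable_good x : measurable (good x).
Proof.
rewrite (_ : good x = \bigcup_K \bigcap_n [set w | dom x n w <= K%:R]).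
  apply: bigcupT_measurable => K; apply: bigcapT_measurable => n.
  rewrite -[X in measurable X]setTI; apply: measurable_fun_le => //.
  exact: measurable_dom.
apply/seteqP; split => w [K]; first by move=> H; exists K => // n _; exact: H.
by move=> _ H; exists K => n; exact: H.
Qed.

Lemma good_tau x w : 0 < x -> good x w -> good x (tau w).
Proof.
move=> x0 [K HK].
set c := if i w then b else x.
have c0 : 0 < c by rewrite /c; case: ifP.
exists (Num.truncn (K%:R / c)).+1 => n.
rewrite (le_trans _ (ltW (truncnS_gt _)))// ler_pdivlMr// mulrC.
by apply: le_trans (HK n.+1); rewrite /= lerDr.
Qed.

(** The envelope is the increasing limit of [dom] to the power s, integrable by monotone
    convergence. It yields both almost sure convergence and a finite s-moment of the limit. *)
Lemma dom_envelope x s : 0 <= x -> 0 < s <= 1 -> x `^ s + b `^ s < 2 ->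
  exists L : T -> \bar R, [/\ P.-integrable setT L, forall w, (0 <= L w)%E &
    forall n w, ((dom x n w `^ s)%:E <= L w)%E].
Proof.
move=> x0 s01 lt2; have /andP[s0 s1] := s01.
pose F n w : \bar R := (dom x n w `^ s)%:E.
have mF n : measurable_fun setT (F n).
  apply/measurable_EFinP; apply: (measurableT_comp (measurable_powR s)).
  exact: measurable_dom.
have F0 n w : (0 <= F n w)%E by rewrite lee_fin powR_ge0.
have ndF w : nondecreasing_seq (F ^~ w).
  apply/nondecreasing_seqP => n; rewrite lee_fin.
  apply: ge0_ler_powR; rewrite ?nnegrE ?dom_ge0 ?(ltW s0)//.
  exact: dom_leS.
have cF w : cvgn (F ^~ w) by exact: ereal_nondecreasing_is_cvgn.
exists (fun w => limn (F ^~ w)); split.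
- have limF0 w : (0 <= limn (F ^~ w))%E.
    by apply: lime_ge => //; apply: nearW => n; exact: F0.
  apply/integrableP; split.
    by apply: (emeasurable_fun_cvg F) => // w _; exact: cF.
  under eq_integral => w _ do rewrite gee0_abs//.
  rewrite monotone_convergence//.
  apply: (@le_lt_trans _ _ ((1 - (x `^ s + b `^ s) / 2)^-1)%:E); last exact: ltry.
  apply: lime_le.
    apply: ereal_nondecreasing_is_cvgn => m n mn; apply: ge0_le_integral => //.
    by move=> w _; exact: ndF.
  by apply: nearW => n; exact: dom_moment.
- by move=> w; apply: lime_ge => //; apply: nearW => n; exact: F0.
- move=> n w; rewrite (cvg_lim _ (ereal_nondecreasing_cvgn (ndF w)))//.
  by apply: ereal_sup_ubound; exists n.
Qed.

Lemma dom_le_envelope x s (L : T -> \bar R) w : 0 <= x -> 0 < s ->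
  (forall n w, ((dom x n w `^ s)%:E <= L w)%E) -> L w \is a fin_num ->
  forall n, dom x n w <= (fine (L w)) `^ s^-1.
Proof.
move=> x0 s0 HL fin n.
have Dr : dom x n w `^ s <= fine (L w) by rewrite -lee_fin fineK.
have -> : dom x n w = (dom x n w `^ s) `^ s^-1.
  by rewrite -powRrM mulfV ?gt_eqF// powRr1// dom_ge0.
apply: ge0_ler_powR; rewrite ?invr_ge0 ?nnegrE ?powR_ge0 ?(ltW s0)//.
by rewrite (le_trans _ Dr)// powR_ge0.
Qed.

Lemma ae_good x : 0 < x -> x * b < 1 -> {ae P, forall w, good x w}.
Proof.
move=> x0 xb.
have [s s01 lt2] := powR_sum_lt2 x0 b0 xb.
have /andP[s0 s1] := s01.
have [L [iL L0 HL]] := dom_envelope (ltW x0) s01 lt2.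
have := integrable_ae measurableT iL; apply: filterS => w /(_ Logic.I) fin.
exists (Num.truncn (fine (L w) `^ s^-1)).+1 => n.
rewrite (le_trans _ (ltW (truncnS_gt _)))//.
exact: (dom_le_envelope (ltW x0) s0 HL fin).
Qed.

End Walk.

(** * The limiting perpetuity and its dependence on the parameter *)

Section Limit.
Context d (T : measurableType d) (R : realType) (P : probability T R).
Variables (i : T -> bool) (tau : T -> T).
Hypotheses (mi : measurable_fun setT i) (mtau : measurable_fun setT tau).
Hypothesis coinP : coin_shift P i tau.
Variables b z : R.
Hypotheses (b0 : 0 < b) (z0 : 0 < z) (zb : z * b < 1).
Implicit Types (x y : R) (n : nat) (w : T).
Local Notation perp := (perp i tau b).
Local Notation dom := (dom i tau b).
Local Notation good := (good i tau b z).

(** The indicator makes the sequence converge everywhere, so that the limit is measurable. The event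
    is taken at z and hence does not vary with x. *)
Definition perpetuity x w : R := limn (fun n => \1_good w * perp x n w).

Lemma perp_cvg x w : 0 <= x <= z -> good w ->
  perp x ^~ w @ \oo --> perpetuity x w.
Proof.
move=> xz gw; have -> : perpetuity x w = limn (perp x ^~ w).
  by congr (limn _); apply/funext => n; rewrite indicE mem_set// mul1r.
have /andP[x0 _] := xz; have [K HK] := gw.
apply: nondecreasing_is_cvgn.
  by apply/nondecreasing_seqP => n; exact: perp_leS.
exists K%:R => _ [n _ <-].
apply: (le_trans (perp_le_dom i tau b0 n w x0)).
by apply: le_trans (HK n); exact: dom_mono.
Qed.

Lemma measurable_perpetuity x : 0 <= x <= z -> measurable_fun setT (perpetuity x).
Proof.
move=> xz.
apply: (@measurable_fun_cvg _ _ _ _ (fun n w => \1_good w * perp x n w)).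
  move=> n; apply: measurable_funM.
    by apply: measurable_indic; exact: measurable_good.
  exact: measurable_perp.
move=> w _; have [gw|gw] := pselect (good w).
  rewrite indicE mem_set//; under eq_fun do rewrite mul1r.
  exact: perp_cvg.
apply: cvgP; rewrite indicE memNset//; under eq_fun do rewrite mul0r.
exact: cvg_cst.
Qed.

Lemma perpetuity_rec x w : 0 <= x <= z -> good w ->
  perpetuity x w =
    if i w then b * perpetuity x (tau w) else 1 + x * perpetuity x (tau w).
Proof.
move=> xz gw; have gt : good (tau w) by exact: good_tau.
have H := perp_cvg xz gw; have Ht := perp_cvg xz gt.
rewrite -(cvg_lim _ H)//; apply: cvg_lim => //.
rewrite -cvg_shiftS /=; case: (i w); first exact: cvgMl_tmp.
by apply: cvgD; [exact: cvg_cst|exact: cvgMl_tmp].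
Qed.

Lemma perp_le_perpetuity x n w : 0 <= x <= z -> good w ->
  perp x n w <= perpetuity x w.
Proof.
move=> xz gw; have H := perp_cvg xz gw.
rewrite -(cvg_lim _ H)//; apply: nondecreasing_cvgn_le; last by apply: cvgP H.
by apply/nondecreasing_seqP => m; apply: perp_leS => //; case/andP: xz.
Qed.

Lemma perpetuity_ge0 x w : 0 <= x <= z -> good w -> 0 <= perpetuity x w.
Proof. by move=> xz gw; exact: (perp_le_perpetuity 0). Qed.

Lemma perpetuity_mono x y w : 0 <= x <= y -> y <= z -> good w ->
  perpetuity x w <= perpetuity y w.
Proof.
move=> /andP[x0 xy] yz gw.
have xz : 0 <= x <= z by rewrite x0 (le_trans xy).
have y0z : 0 <= y <= z by rewrite yz (le_trans x0).
apply: (ler_cvg_to (perp_cvg xz gw) (perp_cvg y0z gw)).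
by apply: nearW => n; apply: perp_mono; rewrite // x0.
Qed.

Lemma perpetuity_lipschitz x y w : 0 <= x <= y -> y <= z -> good w ->
  (z - y) * (perpetuity y w - perpetuity x w) <= (y - x) * perpetuity z w.
Proof.
move=> /andP[x0 xy] yz gw.
have xz : 0 <= x <= z by rewrite x0 (le_trans xy).
have y0z : 0 <= y <= z by rewrite yz (le_trans x0).
have zz : 0 <= z <= z by rewrite lexx ltW.
have H1 : (fun n => (z - y) * (perp y n w - perp x n w)) @ \oo -->
    (z - y) * (perpetuity y w - perpetuity x w).
  by apply: cvgMl_tmp; apply: cvgB; exact: perp_cvg.
have H2 : (fun n => (y - x) * perp z n w) @ \oo --> (y - x) * perpetuity z w.
  by apply: cvgMl_tmp; exact: perp_cvg.
apply: (ler_cvg_to H1 H2); apply: nearW => n.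
by apply: perp_lipschitz => //; rewrite x0.
Qed.

End Limit.

(** * Stationary measures *)

Lemma bounded_ecvg_integral d (T : measurableType d) (R : realType)
    (P : probability T R) (f_ : (T -> \bar R)^nat) (f : T -> \bar R) (M : R) :
  (forall n, measurable_fun setT (f_ n)) -> measurable_fun setT f ->
  (forall n w, `|f_ n w| <= M%:E)%E ->
  {ae P, forall w, f_ ^~ w @ \oo --> f w} ->
  (\int[P]_w f_ n w)%E @[n --> \oo] --> (\int[P]_w f w)%E.
Proof.
move=> mf_ mf fM cf.
have [|||_ _ //] := @dominated_convergence _ _ _ P setT measurableT f_ f
  (cst M%:E) mf_ mf.
- by apply: filterS cf => w + _.
- exact: finite_measure_integrable_cst.
- by apply: aeW => w n _.
Qed.

Lemma bounded_cvg_integral d (T : measurableType d) (R : realType)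
    (P : probability T R) (f_ : (T -> R)^nat) (f : T -> R) (M : R) :
  (forall n, measurable_fun setT (fun w => (f_ n w)%:E)) ->
  measurable_fun setT (fun w => (f w)%:E) ->
  (forall n w, `|(f_ n w)%:E| <= M%:E)%E ->
  {ae P, forall w, f_ ^~ w @ \oo --> f w} ->
  (\int[P]_w (f_ n w)%:E)%E @[n --> \oo] --> (\int[P]_w (f w)%:E)%E.
Proof.
move=> mf_ mf fM cf; apply: (bounded_ecvg_integral (M := M)) => //.
by apply: filterS cf => w H; apply: cvg_EFin => //; exact: nearW.
Qed.

Section Stationary.
Context d (T : measurableType d) (R : realType) (P : probability T R).
Variables (i : T -> bool) (tau : T -> T).
Hypotheses (mi : measurable_fun setT i) (mtau : measurable_fun setT tau).
Hypothesis coinP : coin_shift P i tau.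
Variables d1 d2 b z : R.
Hypotheses (b1 : 1 < b) (z0 : 0 < z) (zb : z * b < 1).
Implicit Types (x y s : R) (n : nat) (w : T).
Local Notation perp := (perp i tau b).
Local Notation dom := (dom i tau b).
Local Notation good := (good i tau b z).
Local Notation perpetuity := (perpetuity i tau b z).

Let b0 : 0 < b. Proof. exact: lt_trans b1. Qed.

Definition fixpt : R := d2 / (1 - b).

(* In the coordinate centred at the fixed point of the second map, the first map
   has offset [d1 - fixpt + x * fixpt], and a stationary variable is that offset
   times the normalised perpetuity. *)
Definition statvar x w : R := fixpt + (d1 - fixpt + x * fixpt) * perpetuity x w.

Definition step x (c : bool) (s : R) : R := if c then b * s + d2 else x * s + d1.

(** Backward iteration: the first flip selects the outermost map. In this order the iterates
    converge pointwise, not merely in law. *)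
Fixpoint orbit x n s w : R :=
  if n is n'.+1 then step x (i w) (orbit x n' s (tau w)) else s.

Let fixptE : d2 = fixpt - b * fixpt.
Proof. by rewrite /fixpt; field; rewrite subr_eq0 lt_eqF. Qed.

Lemma measurable_step x c : measurable_fun setT (step x c).
Proof.
by case: c; apply: measurable_funD => //; exact: measurable_funM.
Qed.

Lemma measurable_orbit x n s : measurable_fun setT (orbit x n s).
Proof.
elim: n => [|n IH] /=; first exact: measurable_cst.
rewrite (_ : (fun w => _) = fun w => if i w then step x true (orbit x n s (tau w))
   else step x false (orbit x n s (tau w))); last by apply/funext => w; case: (i w).
apply: measurable_fun_ifT => //;
  by apply: (measurableT_comp (measurable_step x _)); exact: (measurableT_comp IH).
Qed.

Lemma measurable_statvar x : 0 <= x <= z -> measurable_fun setT (statvar x).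
Proof.
move=> xz; apply: measurable_funD => //; apply: measurable_funM => //.
exact: measurable_perpetuity.
Qed.

Lemma statvar_rec x w : 0 <= x <= z -> good w ->
  statvar x w = step x (i w) (statvar x (tau w)).
Proof.
move=> xz gw; rewrite /statvar (perpetuity_rec b0 z0 xz gw) /step.
by case: (i w); rewrite ?[X in _ = _ + X]fixptE; ring.
Qed.

(** The starting point s enters only through s - [fixpt] times the product of the first n slopes, an
    increment of [dom], which tends to 0 where [dom] converges. *)
Lemma orbitE x n s w :
  orbit x n s w = fixpt + (d1 - fixpt + x * fixpt) * perp x n w +
    (s - fixpt) * (dom x n.+1 w - dom x n w).
Proof.
elim: n w => [|n IH] w; first by rewrite /=; ring.
rewrite [LHS]/= IH /step.
have -> : dom x n.+2 w - dom x n.+1 w = (if i w then b else x) *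
    (dom x n.+1 (tau w) - dom x n (tau w)).
  by rewrite /=; ring.
rewrite [perp x n.+1 w]/=.
by case: (i w); rewrite ?[X in _ + X = _]fixptE; ring.
Qed.

Lemma orbit_cvg x s w : 0 <= x <= z -> good w ->
  orbit x n s w @[n --> \oo] --> statvar x w.
Proof.
move=> xz gw; have /andP[x0 _] := xz.
under eq_fun do rewrite orbitE.
rewrite -[statvar x w]addr0 -(mulr0 (s - fixpt)).
apply: cvgD.
  by apply: cvgD; [exact: cvg_cst|apply: cvgMl_tmp; exact: perp_cvg].
apply: cvgMl_tmp.
have cd : cvgn (dom x ^~ w).
  apply: nondecreasing_is_cvgn.
    by apply/nondecreasing_seqP => n; exact: dom_leS.
  have [K HK] := gw; exists K%:R => _ [n _ <-].
  by apply: le_trans (HK n); exact: dom_mono.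
rewrite -(subrr (limn (dom x ^~ w))); apply: cvgB => //.
by rewrite (cvg_shiftS (dom x ^~ w)).
Qed.

(** The law of [statvar x] works: almost surely it is the map chosen by the first flip applied to
    its own shifted copy. *)
Lemma stationary_statvar x : 0 < x <= z -> exists mu,
  stationary d1 d2 x b mu.
Proof.
move=> /andP[x0 xz]; have xz' : 0 <= x <= z by rewrite (ltW x0).
have mX : measurable_fun setT (statvar x : T -> measurableTypeR R).
  exact: measurable_statvar.
have mS c (A : set (measurableTypeR R)) (mA : measurable A) : measurable (statvar x @^-1` (step x c @^-1` A)).
  rewrite -[X in measurable X]setTI; apply: mX => //.
  by rewrite -[X in measurable X]setTI; exact: measurable_step.
have mSA (A : set (measurableTypeR R)) (mA : measurable A) : measurable (statvar x @^-1` A).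
  by rewrite -[X in measurable X]setTI; exact: mX.
pose X : {mfun T >-> measurableTypeR R} :=
  HB.pack (statvar x : T -> measurableTypeR R) (isMeasurableFun.Build _ _ _ _ _ mX).
exists (distribution P X : probability (measurableTypeR R) R) => A mA.
rewrite /distribution /pushforward.
pose F c w : \bar R := (\1_(statvar x @^-1` (step x c @^-1` A)) w)%:E.
have mF c : measurable_fun setT (F c).
  by apply/measurable_EFinP; apply: measurable_indic; exact: mS.
have F0 c w : (0 <= F c w)%E by rewrite lee_fin.
have PF c : (\int[P]_w F c w = P (statvar x @^-1` (step x c @^-1` A)))%E.
  by rewrite integral_indic ?setIT//; exact: mS.
transitivity (\int[P]_w (if i w then F true (tau w) else F false (tau w)))%E.
  have mXA := mSA A mA.
  transitivity (\int[P]_w (\1_(statvar x @^-1` A) w)%:E)%E.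
    by rewrite integral_indic ?setIT.
  apply: ae_eq_integral => //.
  - exact/measurable_EFinP/measurable_indic.
  - by apply: measurable_fun_ifT => //; exact: measurableT_comp.
  have := ae_good mi mtau coinP b0 z0 zb; apply: filterS => w gw _.
  have e : statvar x w = step x (i w) (statvar x (tau w)) by exact: statvar_rec.
  rewrite /F !indicE; case: ifP => iw; rewrite iw in e; congr ((nat_of_bool _)%:R%:E);
    by apply/idP/idP; rewrite !inE /= e.
rewrite coinP// !PF ge0_muleDr ?measure_ge0//.
Qed.

Lemma integral_stationary_step x (mu : probability (measurableTypeR R) R)
    (f : R -> \bar R) : stationary d1 d2 x b mu ->
  measurable_fun setT f -> (forall t, 0 <= f t)%E ->
  (\int[mu]_t f t = (2^-1)%:E *
     (\int[mu]_t f (step x false t) + \int[mu]_t f (step x true t)))%E.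
Proof.
move=> smu mf f0.
have h0 : 0 <= 2^-1 :> R by rewrite invr_ge0 ler0n.
have mstep c : measurable_fun setT
    (step x c : measurableTypeR R -> measurableTypeR R) by exact: measurable_step.
pose X c : {mfun measurableTypeR R >-> measurableTypeR R} :=
  HB.pack (step x c : measurableTypeR R -> measurableTypeR R)
    (isMeasurableFun.Build _ _ _ _ _ (mstep c)).
pose mu' c : probability (measurableTypeR R) R := distribution mu (X c).
rewrite (@eq_measure_integral _ _ _ _
  (mscale (NngNum h0) (measure_add (mu' false) (mu' true)))).
  rewrite ge0_integral_mscale//= ge0_integral_measure_add//=.
  by rewrite !ge0_integral_distribution.
move=> A mA _; apply: etrans (smu A mA) _.
transitivity ((2^-1)%:E * (mu' false A + mu' true A))%E.
  by rewrite ge0_muleDr.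
by congr (_ * _)%E; exact/esym/measure_addE.
Qed.

(** Stationarity iterated n times. The induction absorbs the outermost map into f, and carries along
    the measurability in s that integration against mu requires. *)
Lemma integral_orbit x (mu : probability (measurableTypeR R) R) n
    (f : R -> \bar R) : stationary d1 d2 x b mu ->
  measurable_fun setT f -> (forall t, 0 <= f t)%E ->
  measurable_fun setT (fun s => \int[P]_w f (orbit x n s w))%E /\
  (\int[mu]_s \int[P]_w f (orbit x n s w) = \int[mu]_t f t)%E.
Proof.
move=> smu; elim: n f => [|n IH] f mf f0.
  rewrite /=; have e s : (\int[P]_w f s = f s)%E.
    by rewrite integral_cst//= probability_setT mule1.
  under eq_fun do rewrite e.
  by split=> //; apply: eq_integral => s _; rewrite e.
have mfs c : measurable_fun setT (f \o step x c).
  exact: (measurableT_comp mf (measurable_step x c)).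
have E s : (\int[P]_w f (orbit x n.+1 s w) = (2^-1)%:E *
    (\int[P]_w (f \o step x false) (orbit x n s w) +
     \int[P]_w (f \o step x true) (orbit x n s w)))%E.
  have H c : measurable_fun setT (fun w => (f \o step x c) (orbit x n s w)).
    by apply: (measurableT_comp (mfs c)); exact: measurable_orbit.
  have H0 c w : (0 <= (f \o step x c) (orbit x n s w))%E by exact: f0.
  rewrite -(coinP (H false) (H true) (H0 false) (H0 true)).
  by apply: eq_integral => w _ /=; case: (i w).
have [m0 I0] := IH (f \o step x false) (mfs false) (fun t => f0 _).
have [m1 I1] := IH (f \o step x true) (mfs true) (fun t => f0 _).
split.
  under eq_fun do rewrite E.
  by apply: measurable_funeM; exact: emeasurable_funD.
under eq_integral do rewrite E.
have J0 c s : (0 <= \int[P]_w (f \o step x c) (orbit x n s w))%E.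
  by apply: integral_ge0 => w _; exact: f0.
rewrite ge0_integralZl//; last 2 first.
- exact: emeasurable_funD.
- by move=> s _; rewrite adde_ge0.
rewrite ge0_integralD//.
by rewrite I0 I1 -integral_stationary_step.
Qed.

(** Backward orbits forget their starting point, so dominated convergence in w and in s identifies
    the integral for every stationary mu. Uniqueness, as far as it matters here, is thereby
    included. *)
Lemma integral_stationary x (mu : probability (measurableTypeR R) R)
    (f : R -> R) (M : R) : 0 < x <= z -> stationary d1 d2 x b mu ->
  continuous f -> (forall t, 0 <= f t <= M) ->
  (\int[mu]_t (f t)%:E = \int[P]_w (f (statvar x w))%:E)%E.
Proof.
move=> /andP[x0 xz] smu cf fM; have xz' : 0 <= x <= z by rewrite (ltW x0).
have mf : measurable_fun setT f by exact: continuous_measurable_fun.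
have mfE : measurable_fun setT (EFin \o f) by exact/measurable_EFinP.
have nf t : (`|(f t)%:E| <= M%:E)%E.
  by have /andP[f0 f1] := fM t; rewrite abse_EFin ger0_norm.
have M0 : 0 <= M by have /andP[f0 f1] := fM 0; exact: le_trans f1.
have mo n s : measurable_fun setT (fun w => (f (orbit x n s w))%:E).
  by apply: (measurableT_comp mfE); exact: measurable_orbit.
have mX : measurable_fun setT (fun w => (f (statvar x w))%:E).
  exact: (measurableT_comp mfE (measurable_statvar xz')).
have inner s : (\int[P]_w (f (orbit x n s w))%:E)%E @[n --> \oo] -->
    (\int[P]_w (f (statvar x w))%:E)%E.
  apply: (@bounded_cvg_integral _ _ _ P _ _ M) => //.
  have := ae_good mi mtau coinP b0 z0 zb; apply: filterS => w gw.
  by apply: continuous_cvg; [exact: cf|exact: orbit_cvg].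
pose J n s : \bar R := (\int[P]_w (f (orbit x n s w))%:E)%E.
have f0 t : (0 <= (f t)%:E)%E by rewrite lee_fin; case/andP: (fM t).
have JE n := integral_orbit n smu mfE f0.
have outer : (\int[mu]_s J n s)%E @[n --> \oo] -->
    (\int[mu]_s (cst (\int[P]_w (f (statvar x w))%:E) s))%E.
  apply: (@bounded_ecvg_integral _ _ _ mu _ _ M) => //.
  - by move=> n; have [] := JE n.
  - move=> n s; rewrite gee0_abs ?integral_ge0//.
    rewrite -[leRHS]mule1 -(probability_setT P) -integral_cst//.
    by apply: ge0_le_integral => // w _; rewrite lee_fin; case/andP: (fM (orbit x n s w)).
  - by apply: aeW => s; exact: inner.
have : (\int[mu]_s J n s)%E @[n --> \oo] --> (\int[mu]_t (f t)%:E)%E.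
  rewrite (_ : (fun n => _) = cst (\int[mu]_t (f t)%:E)%E); first exact: cvg_cst.
  by apply/funext => n; have [] := JE n.
move=> /cvg_lim <-//; rewrite (cvg_lim _ outer)//.
by rewrite integral_cst//= probability_setT mule1.
Qed.

End Stationary.

(** * Continuity and tightness of the law in the parameter *)

Lemma bounded_integrable d (T : measurableType d) (R : realType)
    (P : probability T R) (f : T -> R) (M : R) :
  measurable_fun setT f -> (forall w, `|f w| <= M) ->
  P.-integrable setT (EFin \o f).
Proof.
move=> mf fM; apply: (@le_integrable _ _ _ P setT measurableT _ (cst M%:E)).
- exact/measurable_EFinP.
- by move=> w _ /=; rewrite lee_fin (le_trans (fM w))// ler_norm.
- exact: finite_measure_integrable_cst.
Qed.

Lemma bounded_cvg_Rintegral d (T : measurableType d) (R : realType)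
    (P : probability T R) (f_ : (T -> R)^nat) (f : T -> R) (M : R) :
  (forall n, measurable_fun setT (f_ n)) -> measurable_fun setT f ->
  (forall n w, `|f_ n w| <= M) ->
  {ae P, forall w, f_ ^~ w @ \oo --> f w} ->
  \int[P]_w f_ n w @[n --> \oo] --> \int[P]_w f w.
Proof.
move=> mf_ mf fM cf.
have iM : P.-integrable setT (EFin \o cst M) by exact: finite_measure_integrable_cst.
have [|||if_ _] := @dominated_convergence _ _ _ P setT measurableT
  (fun n w => (f_ n w)%:E) (fun w => (f w)%:E) (cst M%:E)
  (fun n => (measurable_EFinP _ _).2 (mf_ n)) ((measurable_EFinP _ _).2 mf).
- by apply: filterS cf => w H _; apply: cvg_EFin => //; exact: nearW.
- exact: iM.
- by apply: aeW => w n _; rewrite /= lee_fin.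
rewrite -(@fineK _ (\int[P]_(x in _) _)%E); first exact: fine_cvg.
exact: integrable_fin_num.
Qed.

Section Continuity.
Context d (T : measurableType d) (R : realType) (P : probability T R).
Variables (i : T -> bool) (tau : T -> T).
Hypotheses (mi : measurable_fun setT i) (mtau : measurable_fun setT tau).
Hypothesis coinP : coin_shift P i tau.
Variables d1 d2 b z a : R.
Hypotheses (b1 : 1 < b) (zb : z * b < 1) (a0 : 0 < a) (az : a < z).
Implicit Types (x y s : R) (n : nat) (w : T).
Local Notation good := (good i tau b z).
Local Notation perpetuity := (perpetuity i tau b z).
Local Notation statvar := (statvar i tau d1 d2 b z).
Local Notation fixpt := (fixpt d2 b).

Let z0 : 0 < z. Proof. exact: lt_trans az. Qed.
Let b0 : 0 < b. Proof. exact: lt_trans b1. Qed.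

Lemma Rintegral_stationary_measure x (f : R -> R) (M : R) : 0 < x <= z ->
  continuous f -> (forall t, 0 <= f t <= M) ->
  \int[stationary_measure d1 d2 x b]_t f t = \int[P]_w f (statvar x w).
Proof.
move=> xz cf fM; rewrite /Rintegral.
have [mu0 smu0] := stationary_statvar mi mtau coinP d1 d2 b1 z0 zb xz.
have smu : stationary d1 d2 x b (stationary_measure d1 d2 x b).
  exact: (@xgetI _ _ [set mu | stationary d1 d2 x b mu] mu0).
by rewrite (integral_stationary mi mtau coinP b1 z0 zb xz smu cf fM).
Qed.

Let measurable_fX x (f : R -> R) : a <= x <= z -> measurable_fun setT f ->
  measurable_fun setT (fun w => f (statvar x w)).
Proof.
move=> /andP[ax xz] mf; apply: (measurableT_comp mf).
by apply: measurable_statvar => //; rewrite xz (le_trans (ltW a0)).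
Qed.

Lemma statvar_cvg (x_ : R^nat) w : good w -> (forall n, a <= x_ n <= z) ->
  x_ @ \oo --> a -> statvar (x_ n) w @[n --> \oo] --> statvar a w.
Proof.
move=> gw xz xa; rewrite /statvar.
apply: cvgD; first exact: cvg_cst.
apply: cvgM.
  apply: cvgD; first exact: cvg_cst.
  by apply: cvgMr_tmp.
have zz : 0 <= z <= z by rewrite lexx ltW.
have Gz0 : 0 <= perpetuity z w by exact: perpetuity_ge0.
have za2 : 0 < (z - a) / 2 by rewrite divr_gt0// subr_gt0.
(* Monotonicity bounds from below and the convexity bound from above; eventually z - x_n >= (z - a)
   / 2, which fixes the denominator. *)
apply: (@squeeze_cvgr _ _ _ _ (cst (perpetuity a w))
  (fun n => perpetuity a w + (x_ n - a) * (perpetuity z w / ((z - a) / 2)))).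
- have /cvgr_dist_lt /(_ _ za2) := xa; apply: filterS => n xan.
  have /andP[an zn] := xz n.
  have aw : 0 <= a <= x_ n by rewrite an ltW.
  rewrite (perpetuity_mono b0 aw zn gw)/= -lerBlDl mulrA ler_pdivlMr//.
  apply: le_trans (perpetuity_lipschitz b0 z0 aw zn gw).
  rewrite [leRHS]mulrC ler_wpM2l//.
    by rewrite subr_ge0 (perpetuity_mono b0 aw zn gw).
  by move: xan; rewrite distrC ger0_norm ?subr_ge0//; lra.
- exact: cvg_cst.
- rewrite -[X in _ --> X]addr0; apply: cvgD; first exact: cvg_cst.
  rewrite -(mul0r (perpetuity z w / ((z - a) / 2))); apply: cvgMr_tmp.
  by rewrite -(subrr a); apply: cvgB => //; exact: cvg_cst.
Qed.

Lemma expectation_continuous (f : R -> R) (M dlt : R) : continuous f ->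
  (forall t, `|f t| <= M) -> 0 < dlt ->
  exists2 eta, 0 < eta <= z - a & forall x, a <= x <= a + eta ->
    `|\int[P]_w f (statvar x w) - \int[P]_w f (statvar a w)| <= dlt.
Proof.
move=> cf fM dlt0; apply: contrapT => H.
have mf : measurable_fun setT f by exact: continuous_measurable_fun.
have za : 0 < z - a by rewrite subr_gt0.
have {}H n : exists x, a <= x <= a + (z - a) / n.+1%:R /\
    dlt < `|\int[P]_w f (statvar x w) - \int[P]_w f (statvar a w)|.
  apply: contrapT => H'; apply: H; exists ((z - a) / n.+1%:R).
    by rewrite divr_gt0//= ler_pdivrMr// ler_pMr// ler1n.
  move=> x ax; rewrite leNgt; apply/negP => dx; apply: H'.
  by exists x.
have [x_ Hx] := choice H.
have xz n : a <= x_ n <= z.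
  have [/andP[-> h] _] := Hx n; rewrite (le_trans h)//= addrC -lerBrDr.
  by rewrite ler_pdivrMr// ler_pMr// ler1n.
have xa : x_ @ \oo --> a.
  apply: (@squeeze_cvgr _ _ _ _ (cst a) (fun n => a + (z - a) / n.+1%:R)).
  - by apply: nearW => n; have [] := Hx n.
  - exact: cvg_cst.
  - rewrite -[X in _ --> X]addr0; apply: cvgD; first exact: cvg_cst.
    rewrite -(mulr0 (z - a)); apply: cvgMl_tmp; exact: cvg_harmonic.
have cI : \int[P]_w f (statvar (x_ n) w) @[n --> \oo] -->
    \int[P]_w f (statvar a w).
  apply: (@bounded_cvg_Rintegral _ _ _ P _ _ M) => //.
  - by move=> n; exact: measurable_fX.
  - by apply: measurable_fX => //; rewrite lexx ltW.
  have := ae_good mi mtau coinP b0 z0 zb; apply: filterS => w gw.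
  by apply: continuous_cvg; [exact: cf|exact: statvar_cvg].
have /cvgr_dist_lt /(_ _ dlt0) [N _ /(_ N (leqnn N))] := cI.
by rewrite distrC ltNge ltW//; have [_] := Hx N.
Qed.

(** A single variable [Y], built from the perpetuity at z, dominates |[statvar x]| for all x in
    [a, z] at once; hence r does not depend on x. *)
Lemma expectation_tight (dlt : R) : 0 < dlt -> exists r : nat, forall x (f : R -> R),
  a <= x <= z -> measurable_fun setT f -> (forall t, 0 <= f t <= 1) ->
  (forall t, `|t| <= r%:R -> f t = 0) -> \int[P]_w f (statvar x w) <= dlt.
Proof.
move=> dlt0.
pose K := `|d1 - fixpt| + z * `|fixpt|.
pose Y w := `|fixpt| + K * perpetuity z w.
have zz : 0 <= z <= z by rewrite lexx ltW.
have mY : measurable_fun setT Y.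
  by apply: measurable_funD => //; apply: measurable_funM => //;
    exact: measurable_perpetuity.
pose g (n : nat) w : R := \1_[set w | n%:R < Y w] w.
have mg n : measurable_fun setT (g n).
  apply: measurable_indic.
  rewrite (_ : [set w | _] = ~` [set w | Y w <= n%:R]).
    apply: measurableC; rewrite -[X in measurable X]setTI.
    exact: measurable_fun_le.
  by apply/seteqP; split => w /=; rewrite ltNge => /negP.
have g1 n w : `|g n w| <= 1 by rewrite /g indicE; case: (_ \in _); rewrite ?normr1 ?normr0.
have cg : \int[P]_w g n w @[n --> \oo] --> \int[P]_w (cst 0 w : R).
  apply: (@bounded_cvg_Rintegral _ _ _ P _ _ 1) => //.
  apply: aeW => w; apply: cvg_near_cst.
  exists (Num.truncn (Y w)).+1 => // n /= hn.
  rewrite /g indicE memNset//= => /lt_trans /(_ (truncnS_gt _)).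
  by rewrite ltr_nat ltnNge hn.
rewrite Rintegral_cst// mul0r in cg.
have /cvgr_dist_lt /(_ _ dlt0) [r _ /(_ r (leqnn r))] := cg.
rewrite sub0r normrN => hr.
exists r => x f ax mf f01 fr.
have fX1 : P.-integrable setT (EFin \o (fun w => f (statvar x w))).
  apply: (@bounded_integrable _ _ _ _ _ 1); first exact: measurable_fX.
  by move=> w; have /andP[h0 h1] := f01 (statvar x w); rewrite ger0_norm.
apply: le_trans (ltW hr); apply: le_trans (ler_norm _).
have ig : P.-integrable setT (EFin \o g r) by exact: bounded_integrable.
have mE : measurable_fun setT (fun w => (f (statvar x w))%:E).
  by apply/measurable_EFinP; exact: measurable_fX.
rewrite /Rintegral fine_le ?integrable_fin_num//.
apply: ae_ge0_le_integral => //.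
- by move=> w _; rewrite lee_fin; case/andP: (f01 (statvar x w)).
- by move=> w _; rewrite lee_fin /g indicE.
- exact/measurable_EFinP.
have := ae_good mi mtau coinP b0 z0 zb; apply: filterS => w gw _.
rewrite lee_fin /g indicE.
have [Yr|Yr] := boolP (r%:R < Y w).
  by rewrite mem_set//; case/andP: (f01 (statvar x w)).
rewrite memNset/=; last exact/negP.
rewrite fr//; move: Yr; rewrite -leNgt; apply: le_trans.
rewrite /statvar /Y (le_trans (ler_normD _ _))// lerD2l normrM.
have /andP[ax1 xz] := ax.
have x0 : 0 <= x by rewrite (le_trans (ltW a0)).
have x0z : 0 <= x <= z by rewrite x0.
apply: ler_pM => //.
  rewrite (le_trans (ler_normD _ _))// lerD2l normrM ger0_norm//.
  by rewrite ler_wpM2r.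
rewrite ger0_norm; last exact: perpetuity_ge0.
by apply: perpetuity_mono => //; rewrite x0.
Qed.

End Continuity.

(** * Concentration near few points *)

Section Concentration.
Context d (T : measurableType d) (R : realType) (P : probability T R).
Variables (i : T -> bool) (tau : T -> T).
Hypotheses (mi : measurable_fun setT i) (mtau : measurable_fun setT tau).
Hypothesis coinP : coin_shift P i tau.
Variables d1 d2 b z a : R.
Hypotheses (b1 : 1 < b) (zb : z * b < 1) (a0 : 0 < a) (az : a < z).
Implicit Types (x y s : R) (n : nat) (w : T).
Local Notation good := (good i tau b z).
Local Notation perp := (perp i tau b).
Local Notation dom := (dom i tau b).
Local Notation perpetuity := (perpetuity i tau b z).
Local Notation statvar := (statvar i tau d1 d2 b z).
Local Notation fixpt := (fixpt d2 b).

Let z0 : 0 < z. Proof. exact: lt_trans az. Qed.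
Let b0 : 0 < b. Proof. exact: lt_trans b1. Qed.
Let a0z : 0 <= a <= z. Proof. by rewrite !ltW. Qed.

Fixpoint perp_values n : seq R :=
  if n is n'.+1 then
    [seq b * v | v <- perp_values n'] ++ [seq 1 + a * v | v <- perp_values n']
  else [:: 0].

Lemma size_perp_values n : size (perp_values n) = (2 ^ n)%N.
Proof. by elim: n => //= n IH; rewrite size_cat !size_map IH addnn expnS mul2n. Qed.

Lemma perp_in_values n w : perp a n w \in perp_values n.
Proof.
elim: n w => [|n IH] w /=; first by rewrite inE.
rewrite mem_cat; case: (i w); apply/orP; [left|right]; exact: map_f.
Qed.

Section Gap.
Variable r : R.
Hypothesis r0 : 0 < r.

(* Distance of the perpetuity to its n-th partial sum, which takes at most 2^n
   values, in units of r^n. *)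
Definition gap n w : R := \1_good w * ((perpetuity a w - perp a n w) / r ^+ n).

Lemma measurable_gap n : measurable_fun setT (gap n).
Proof.
apply: measurable_funM; first by apply: measurable_indic; exact: measurable_good.
apply: measurable_funM => //; apply: measurable_funB.
  exact: measurable_perpetuity.
exact: measurable_perp.
Qed.

Lemma gap_ge0 n w : 0 <= gap n w.
Proof.
rewrite /gap indicE; have [gw|gw] := pselect (good w); last by rewrite memNset// mul0r.
rewrite mem_set// mul1r divr_ge0 ?exprn_ge0 ?(ltW r0)// subr_ge0.
exact: perp_le_perpetuity.
Qed.

Lemma gap_rec n w : good w ->
  gap n.+1 w = (if i w then b / r else a / r) * gap n (tau w).
Proof.
move=> gw; have gt : good (tau w) by exact: good_tau.
rewrite /gap !indicE !mem_set// !mul1r (perpetuity_rec b0 z0 a0z gw) /= exprS.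
by case: (i w); field; rewrite expf_neq0 gt_eqF.
Qed.

(** One flip multiplies the gap by a/r or b/r with no additive term, so its s-moment is exactly
    geometric in n. *)
Lemma gap_moment s n : 0 < s ->
  (\int[P]_w (gap n w `^ s)%:E =
   ((((a / r) `^ s + (b / r) `^ s) / 2) ^+ n)%:E * \int[P]_w (gap 0 w `^ s)%:E)%E.
Proof.
move=> s0; set q := _ / 2.
have q0 : 0 <= q by rewrite divr_ge0// addr_ge0// powR_ge0.
have mg m : measurable_fun setT (fun w => (gap m w `^ s)%:E).
  apply/measurable_EFinP; apply: (measurableT_comp (measurable_powR s)).
  exact: measurable_gap.
elim: n => [|n IH]; first by rewrite expr0 mul1e.
pose F (c : R) w : \bar R := ((c `^ s)%:E * (gap n w `^ s)%:E)%E.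
have F0 c w : (0 <= F c w)%E by rewrite /F -EFinM lee_fin mulr_ge0// powR_ge0.
have mF c : measurable_fun setT (F c) by exact: emeasurable_funM.
have intF c : (\int[P]_w F c w = (c `^ s)%:E * \int[P]_w (gap n w `^ s)%:E)%E.
  rewrite ge0_integralZl//; first by move=> w _; rewrite lee_fin powR_ge0.
  by rewrite lee_fin powR_ge0.
transitivity (\int[P]_w (if i w then F (b / r)%R (tau w) else F (a / r)%R (tau w)))%E.
  apply: ae_eq_integral => //.
    by apply: measurable_fun_ifT => //; exact: measurableT_comp.
  have := ae_good mi mtau coinP b0 z0 zb; apply: filterS => w gw _.
  rewrite gap_rec// /F; case: (i w); rewrite powRM ?EFinM ?gap_ge0//;
    by rewrite divr_ge0// ltW.
rewrite coinP// !intF -ge0_muleDl ?lee_fin ?powR_ge0// IH !muleA.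
by congr (_ * _)%E; rewrite -EFinD -!EFinM /q; congr EFin; rewrite exprS; ring.
Qed.

End Gap.

(* The unit 1 is immaterial here, as the scaling is trivial for n = 0. *)
Lemma gap0_moment s : 0 < s <= 1 -> a `^ s + b `^ s < 2 ->
  (\int[P]_w (gap 1 0 w `^ s)%:E < +oo)%E.
Proof.
move=> s01 lt2; have /andP[s0 s1] := s01.
have [L [iL L0 HL]] := dom_envelope mi mtau coinP b0 (ltW a0) s01 lt2.
apply: (@le_lt_trans _ _ (\int[P]_w L w)%E); last first.
  have /integrableP[_] := iL; under eq_integral => w _ do rewrite gee0_abs//.
  by [].
have mL := measurable_int _ iL.
apply: ge0_le_integral => //.
- by move=> w _; rewrite lee_fin powR_ge0.
- apply/measurable_EFinP; apply: (measurableT_comp (measurable_powR s)).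
  exact: measurable_gap.
move=> w _; rewrite /gap indicE subr0 expr0 divr1.
have [gw|gw] := pselect (good w); last first.
  by rewrite memNset// mul0r powR0 ?gt_eqF.
rewrite mem_set// mul1r.
have := L0 w; case E : (L w) => [l| |] // l0; last by rewrite leey.
have Hl n : dom a n w <= l `^ s^-1.
  have fin : L w \is a fin_num by rewrite E.
  by have := dom_le_envelope b0 (ltW a0) s0 HL fin n; rewrite E.
have Gl : perpetuity a w <= l `^ s^-1.
  have c := perp_cvg b0 a0z gw.
  rewrite -(cvg_lim _ c)//; apply: limr_le; first by apply: cvgP c.
  by apply: nearW => n; rewrite (le_trans _ (Hl n))// perp_le_dom// ltW.
rewrite lee_fin in l0; rewrite lee_fin.
have -> : l = (l `^ s^-1) `^ s by rewrite -powRrM mulVf ?gt_eqF// powRr1.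
apply: ge0_ler_powR; rewrite ?nnegrE ?powR_ge0 ?(ltW s0)//.
exact: perpetuity_ge0.
Qed.

Lemma concentration : a * b < 4^-1 ->
  exists r K : R, [/\ 0 < r < 2^-1, 0 < K &
    forall dlt, 0 < dlt -> exists n0 : nat, forall n, (n0 <= n)%N ->
      exists (Y : seq R) (B : set T), [/\ size Y = (2 ^ n)%N, measurable B,
        (P (~` B) <= dlt%:E)%E &
        forall w, B w -> exists2 y, y \in Y & `|statvar a w - y| <= K * r ^+ n]].
Proof.
move=> ab4.
have ab0 : 0 < a * b by rewrite mulr_gt0.
(* r^2 is the midpoint of a b and 1/4: this gives r < 1/2 and (a/r)(b/r) < 1 together. *)
pose r := Num.sqrt ((a * b + 4^-1) / 2).
have r2 : r ^+ 2 = (a * b + 4^-1) / 2 by rewrite sqr_sqrtr//; lra.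
have r0 : 0 < r by rewrite sqrtr_gt0; lra.
have rh : r < 2^-1.
  rewrite -(@ltr_pXn2r _ 2)// ?nnegrE ?invr_ge0 ?ltW//.
  by rewrite r2 expr2; lra.
have r1 : r < 1 by lra.
have [s s01 lt2] : exists2 s, 0 < s <= 1 & (a / r) `^ s + (b / r) `^ s < 2.
  apply: powR_sum_lt2; rewrite ?divr_gt0//.
  rewrite mulf_div -expr2 ltr_pdivrMr ?exprn_gt0// mul1r r2; lra.
have /andP[s0 s1] := s01.
(* The same s serves the unscaled slopes, since r < 1. *)
have lt2' : a `^ s + b `^ s < 2.
  have le c : 0 < c -> c `^ s <= (c / r) `^ s.
    move=> c0; apply: ge0_ler_powR; rewrite ?nnegrE ?divr_ge0 ?(ltW s0) ?(ltW c0) ?(ltW r0)//.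
    by rewrite ler_pdivlMr// ler_piMr// ltW.
  by apply: le_lt_trans lt2; apply: lerD; exact: le.
set q := ((a / r) `^ s + (b / r) `^ s) / 2.
have q1 : q < 1 by rewrite /q; lra.
have q0 : 0 <= q by rewrite divr_ge0// addr_ge0// powR_ge0.
have M0 := gap0_moment s01 lt2'.
have gap01 w : gap r 0 w = gap 1 0 w by rewrite /gap !expr0.
set m := fine (\int[P]_w (gap 1 0 w `^ s)%:E)%E.
have mE : (\int[P]_w (gap 1 0 w `^ s)%:E)%E = m%:E.
  by rewrite fineK// ge0_fin_numE//; apply: integral_ge0 => w _; rewrite lee_fin powR_ge0.
pose k := d1 - fixpt + a * fixpt.
exists r, (`|k| + 1); split; [by rewrite r0|by rewrite ltr_wpDl|].
move=> dlt dlt0.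
have cq : q ^+ n * m @[n --> \oo] --> (0 : R).
  rewrite -(mul0r m); apply: cvgMr_tmp; apply: cvg_expr.
  by rewrite ger0_norm.
have /cvgr0_norm_le /(_ _ dlt0) [n0 _ Hn0] := cq.
exists n0 => n nn0; have {Hn0} := Hn0 n nn0 => qm.
exists [seq fixpt + k * v | v <- perp_values n].
exists (good `&` [set w | gap r n w <= 1]).
have mG : measurable [set w | gap r n w <= 1].
  rewrite -[X in measurable X]setTI; apply: measurable_fun_le => //.
  exact: measurable_gap.
have mgood : measurable good by exact: measurable_good.
split.
- by rewrite size_map size_perp_values.
- exact: measurableI.
- apply: (@le_trans _ _ (q ^+ n * m)%:E); last first.
    by rewrite lee_fin (le_trans _ qm)// ler_norm.
  rewrite EFinM -mE.
  rewrite (_ : (\int[P]_w (gap 1 0 w `^ s)%:E)%E = \int[P]_w (gap r 0 w `^ s)%:E)%E; last first.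
    by apply: eq_integral => w _; rewrite gap01.
  rewrite -gap_moment//.
  have -> : P (~` (good `&` [set w | gap r n w <= 1])) =
      (\int[P]_w (\1_(~` (good `&` [set w | gap r n w <= 1])) w)%:E)%E.
    by rewrite integral_indic ?setIT//; apply: measurableC; exact: measurableI.
  apply: ae_ge0_le_integral => //.
  + by apply/measurable_EFinP/measurable_indic; apply: measurableC; exact: measurableI.
  + by move=> w _; rewrite lee_fin powR_ge0.
  + apply/measurable_EFinP; apply: (measurableT_comp (measurable_powR s)).
    exact: measurable_gap.
  (* Markov's inequality: where the gap exceeds 1, so does its power s. *)
  have := ae_good mi mtau coinP b0 z0 zb; apply: filterS => w gw _.
  rewrite indicE; have [g1|g1] := boolP (gap r n w <= 1).
    by rewrite memNset ?lee_fin ?powR_ge0//= => -[].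
  rewrite mem_set; last by move=> [_] /=; exact/negP.
  rewrite lee_fin /=.
  have {1}-> : 1%:R = 1 `^ s :> R by rewrite powR1.
  apply: ge0_ler_powR; rewrite ?nnegrE ?gap_ge0 ?(ltW s0)//.
  by rewrite ltW// ltNge.
move=> w [gw /= g1]; exists (fixpt + k * perp a n w).
  by apply: map_f; exact: perp_in_values.
rewrite /statvar -/k opprD addrACA subrr add0r -mulrBr normrM.
have := g1; rewrite /gap indicE mem_set// mul1r ler_pdivrMr ?exprn_gt0// mul1r => gr.
have Gp : 0 <= perpetuity a w - perp a n w.
  by rewrite subr_ge0; exact: perp_le_perpetuity.
rewrite (ger0_norm Gp); apply: ler_pM => //.
by rewrite lerDl.
Qed.

End Concentration.

(** * Strict monotonicity on a cylinder *)

Section Cylinder.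
Context d (T : measurableType d) (R : realType) (P : probability T R).
Variables (i : T -> bool) (tau : T -> T).
Hypotheses (mi : measurable_fun setT i) (mtau : measurable_fun setT tau).
Hypothesis coinP : coin_shift P i tau.
Variables d1 d2 b z a : R.
Hypotheses (b1 : 1 < b) (zb : z * b < 1) (a0 : 0 < a) (az : a < z).
Implicit Types (x y s : R) (n m N : nat) (w : T) (l : seq bool).
Local Notation good := (good i tau b z).
Local Notation perpetuity := (perpetuity i tau b z).
Local Notation statvar := (statvar i tau d1 d2 b z).
Local Notation fixpt := (fixpt d2 b).

Let z0 : 0 < z. Proof. exact: lt_trans az. Qed.
Let b0 : 0 < b. Proof. exact: lt_trans b1. Qed.
Let z1 : z <= 1.
Proof.
rewrite leNgt; apply/negP => z1; have := zb; rewrite ltNge => /negP; apply.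
by rewrite -[leLHS]mulr1 ler_pM// ltW.
Qed.

Fixpoint cyl l w : bool :=
  if l is c :: l' then (i w == c) && cyl l' (tau w) else true.

Lemma measurable_cyl l : measurable_fun setT (cyl l).
Proof.
elim: l => [|c l IH] /=; first exact: measurable_cst.
apply: measurable_and; last exact: (measurableT_comp IH).
by case: c; [|rewrite (_ : (fun w => _) = fun w => ~~ i w); [exact: measurable_neg|]];
  [under eq_fun do rewrite eqb_id|apply/funext => w; case: (i w)].
Qed.

Lemma probability_cyl l : P [set w | cyl l w] = ((2^-1 ^+ size l)%:E).
Proof.
have mc l' : measurable [set w | cyl l' w].
  by rewrite -[X in measurable X]setTI; exact: measurable_cyl.
elim: l => [|c l IH].
  by rewrite expr0 -(@probability_setT _ _ _ P); congr (P _); apply/seteqP; split.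
pose F (c' : bool) w : \bar R := (if c' == c then (\1_[set w | cyl l w] w)%:E else 0)%E.
have F0 c' w : (0 <= F c' w)%E by rewrite /F; case: ifP; rewrite ?lee_fin.
have mF c' : measurable_fun setT (F c').
  by rewrite /F; case: (c' == c) => //; exact/measurable_EFinP/measurable_indic.
have I c' : (\int[P]_w F c' w = if c' == c then (2^-1 ^+ size l)%:E else 0)%E.
  rewrite /F; case: (c' == c); last by rewrite integral0.
  by rewrite integral_indic ?setIT.
transitivity (\int[P]_w (\1_[set w | cyl (c :: l) w] w)%:E)%E.
  by rewrite integral_indic ?setIT.
transitivity (\int[P]_w (if i w then F true (tau w) else F false (tau w)))%E.
  apply: eq_integral => w _; rewrite /F !indicE.
  have e : (w \in [set w | cyl (c :: l) w]) = (i w == c) && (tau w \in [set w | cyl l w]).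
    by apply/idP/andP; rewrite !inE /=; [move/andP|case=> -> ->].
  by rewrite e; case: (i w); case: (_ == c).
rewrite coinP// !I exprS EFinM; congr (_ * _)%E.
by case: c {F F0 mF I} => /=; rewrite ?adde0 ?add0e.
Qed.

(** The closing flip of the first map supplies an offset 1, which the m expanding flips multiply by
    b^m. *)
Lemma perpetuity_ge_expansion m x w : a <= x <= z -> good w ->
  cyl (nseq m true ++ [:: false]) w -> b ^+ m <= perpetuity x w.
Proof.
move=> /andP[ax xz]; have x0 : 0 < x by exact: lt_le_trans ax.
have x0z : 0 <= x <= z by rewrite ltW.
elim: m w => [|m IH] w gw /= /andP[/eqP iw cw];
  have gt : good (tau w) by exact: good_tau.
- rewrite (perpetuity_rec b0 z0 x0z gw) iw expr0 lerDl mulr_ge0 ?(ltW x0)//.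
  exact: perpetuity_ge0.
- rewrite (perpetuity_rec b0 z0 x0z gw) iw exprS ler_pM2l//.
  exact: IH.
Qed.

(* N flips of the first map force the logarithmic derivative in x to be at least
   of order N; m flips of the expanding map then make the value large. *)
Lemma perpetuity_spread N m x y w : a <= x <= y -> y <= z -> good w ->
  cyl (nseq N false ++ nseq m true ++ [:: false]) w ->
  exists u, [/\ b ^+ m <= u, perpetuity x w <= N%:R + x ^+ N * u,
    x ^+ N * u <= perpetuity x w &
    N%:R * (x ^+ N * u) * (y - x) <= perpetuity y w - perpetuity x w].
Proof.
move=> /andP[ax xy] yz; have x0 : 0 < x by exact: lt_le_trans ax.
have y0 : 0 < y by exact: lt_le_trans xy.
have x0z : 0 <= x <= z by rewrite ltW//= (le_trans xy).
have y0z : 0 <= y <= z by rewrite ltW.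
have x1 : x <= 1 by rewrite (le_trans xy)// (le_trans yz).
elim: N w => [|N IH] w gw.
  move=> cw; exists (perpetuity x w); rewrite expr0 !mul1r mul0r mul0r add0r.
  split=> //; first by apply: perpetuity_ge_expansion => //; rewrite ax (le_trans xy).
  by rewrite subr_ge0; apply: perpetuity_mono => //; rewrite (ltW x0).
move=> /= /andP[/eqP iw cw].
have gt : good (tau w) by exact: good_tau.
have [u [bu]] := IH _ gt cw.
rewrite (perpetuity_rec b0 z0 x0z gw) (perpetuity_rec b0 z0 y0z gw) iw.
move: (perpetuity x (tau w)) (perpetuity y (tau w)) => g h.
have u0 : 0 <= u by rewrite (le_trans _ bu)// exprn_ge0// ltW.
have Xu0 : 0 <= x ^+ N * u by rewrite mulr_ge0// exprn_ge0// ltW.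
move=> h1 h2 h3; exists u; rewrite exprS -[x * x ^+ N * u]mulrA.
move: h1 h2 h3 Xu0; set v := x ^+ N * u; move=> h1 h2 h3 Xu0; split => //.
- rewrite -natr1; have : x * g <= x * (N%:R + v) by rewrite ler_pM2l.
  have : x * N%:R <= 1 * N%:R by rewrite ler_wpM2r.
  by rewrite mul1r mulrDr; lra.
- by have : x * v <= x * g; [rewrite ler_pM2l|lra].
- have t0 : 0 <= y - x by rewrite subr_ge0.
  have A1 : x * (N%:R * v * (y - x)) <= x * (h - g) by rewrite ler_pM2l.
  have Nv : 0 <= N%:R * v * (y - x) by rewrite mulr_ge0// mulr_ge0.
  have A2 : (y - x) * v <= (y - x) * h.
    by rewrite ler_wpM2l//; lra.
  have A3 : x * (v * (y - x)) <= 1 * (v * (y - x)) by rewrite ler_wpM2r// mulr_ge0.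
  have -> : 1 + y * h - (1 + x * g) = x * (h - g) + (y - x) * h by ring.
  have -> : N.+1%:R * (x * v) * (y - x) = x * (N%:R * v * (y - x)) + x * (v * (y - x)).
    by rewrite -natr1; ring.
  by lra.
Qed.

Hypothesis e0 : d1 - fixpt + a * fixpt != 0.

(** With p the fixed point, X_y - X_x = k(y) (G_y - G_x) + (y - x) p G_x. For v = x^N u from
    [perpetuity_spread], the first term is at least |e|/2 N v (y - x) and the second at most 2 |p| v
    (y - x). Large N makes the first win; m, chosen after N, makes v large. *)
Lemma statvar_spread (rad : R) : exists (A : set T) (c eta : R),
  [/\ measurable A, 0 < c, (c%:E <= P A)%E, 0 < eta <= z - a &
  forall w x y, A w -> a <= x <= y -> y <= a + eta ->
    y - x <= `|statvar y w - statvar x w| /\ rad <= `|statvar x w|].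
Proof.
pose p := fixpt; pose e := d1 - p + a * p.
have ae0 : 0 < `|e| by rewrite normr_gt0 e0.
pose N := (Num.truncn ((2 * `|p| + 1) * 2 / `|e|)).+1.
have HN : 2 * `|p| + 1 <= `|e| * N%:R / 2.
  have : (2 * `|p| + 1) * 2 / `|e| < N%:R by exact: truncnS_gt.
  by rewrite ltr_pdivrMr// => /ltW; lra.
have aN : 0 < a ^+ N by exact: exprn_gt0.
(* Three lower bounds on v in one: v >= N gives G_x <= 2 v, v >= 1 gives slope at least 1, and the
   last summand sends X_x beyond rad. *)
pose Lam := N%:R + 1 + (`|rad| + `|p|) * 2 / `|e|.
have [m Hm] : exists m, Lam / a ^+ N <= b ^+ m.
  have b10 : 0 < b - 1 by rewrite subr_gt0.
  exists (Num.truncn (Lam / a ^+ N / (b - 1))).+1; set m := _.+1.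
  have Hm : Lam / a ^+ N / (b - 1) < m%:R by exact: truncnS_gt.
  rewrite ltr_pdivrMr// in Hm; apply: (le_trans (ltW Hm)).
  have B n : n%:R * (b - 1) <= b ^+ n.
    elim: n => [|n IH]; first by rewrite mul0r expr0 ler01.
    have bn1 : 1 <= b ^+ n by rewrite exprn_ege1// ltW.
    rewrite -natr1 exprS.
    have : (b - 1) * 1 <= (b - 1) * b ^+ n by rewrite ler_pM2l.
    by move: IH; lra.
  exact: B.
rewrite ler_pdivrMr// mulrC in Hm.
pose l := nseq N false ++ nseq m true ++ [:: false].
(* Keeps k(t) within |e|/2 of e = k(a), hence |k(t)| >= |e|/2 on the whole interval. *)
pose eta := Num.min (z - a) (`|e| / 2 / (`|p| + 1)).
have p1 : 0 < `|p| + 1 by rewrite ltr_wpDl.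
have mc : measurable [set w | cyl l w].
  by rewrite -[X in measurable X]setTI; exact: measurable_cyl.
have mg : measurable good by exact: measurable_good.
exists ([set w | cyl l w] `&` good), (2^-1 ^+ size l), eta.
have eta0 : 0 < eta by rewrite lt_min subr_gt0 az !divr_gt0.
split.
- exact: measurableI.
- by rewrite exprn_gt0// invr_gt0.
- rewrite -probability_cyl le_eqVlt; apply/orP; left; apply/eqP.
  transitivity (\int[P]_w (\1_[set w | cyl l w] w)%:E)%E.
    by rewrite integral_indic ?setIT.
  transitivity (\int[P]_w (\1_([set w | cyl l w] `&` good) w)%:E)%E; last first.
    by rewrite integral_indic ?setIT//; exact: measurableI.
  apply: ae_eq_integral => //.
  + exact/measurable_EFinP/measurable_indic.
  + by apply/measurable_EFinP/measurable_indic; exact: measurableI.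
  have := ae_good mi mtau coinP b0 z0 zb; apply: filterS => w gw _.
  rewrite !indicE; congr ((nat_of_bool _)%:R%:E).
  by apply/idP/idP; rewrite !inE /=; [|case].
- by rewrite eta0 ge_min lexx.
move=> w x y [cw gw] axy ye; have /andP[ax xy] := axy.
have etaz : eta <= z - a by rewrite ge_min lexx.
have etae : `|p| * eta <= `|e| / 2.
  have : eta <= `|e| / 2 / (`|p| + 1) by rewrite ge_min lexx orbT.
  rewrite ler_pdivlMr// mulrDr mulr1 mulrC => h.
  by apply: le_trans h; rewrite lerDl ltW.
have yz : y <= z by lra.
have x0 : 0 < x by exact: lt_le_trans ax.
have [u [bu h1 h2 h3]] := perpetuity_spread axy yz gw cw.
have aNx : a ^+ N <= x ^+ N by rewrite lerXn2r// nnegrE ltW.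
have Lx : Lam <= x ^+ N * u.
  apply: (le_trans Hm); apply: ler_pM => //; first exact: ltW.
  by rewrite exprn_ge0// ltW.
have Lam0 : 0 <= (`|rad| + `|p|) * 2 / `|e|.
  by rewrite !mulr_ge0 ?addr_ge0 ?invr_ge0.
have N0 : 0 <= N%:R :> R by rewrite ler0n.
set v := x ^+ N * u in h1 h2 h3 Lx.
have v1 : 1 <= v by rewrite /Lam in Lx; lra.
have vN : N%:R <= v by rewrite /Lam in Lx; lra.
have vr : (`|rad| + `|p|) * 2 <= v * `|e|.
  by rewrite -ler_pdivrMr//; rewrite /Lam in Lx; lra.
pose k t := d1 - p + t * p.
have kE t : k t = e + (t - a) * p by rewrite /k /e; ring.
have kt t : a <= t <= a + eta -> `|k t - e| <= `|e| / 2.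
  move=> /andP[at1 at2]; rewrite kE addrAC subrr add0r normrM mulrC.
  apply: le_trans etae; rewrite ler_wpM2l// ger0_norm ?subr_ge0//.
  by rewrite lerBlDl.
have kge t : a <= t <= a + eta -> `|e| / 2 <= `|k t|.
  by move=> /kt h; have := lerB_dist e (e - k t); rewrite subKr distrC; lra.
have xe : a <= x <= a + eta by rewrite ax (le_trans xy).
have ye' : a <= y <= a + eta by rewrite ye (le_trans ax).
have t0 : 0 <= y - x by rewrite subr_ge0.
rewrite /statvar -/p -/(k x) -/(k y).
move: h1 h2 h3; set g := perpetuity x w; set h := perpetuity y w => h1 h2 h3.
have v0 : 0 <= v by lra.
have g0 : 0 <= g by lra.
split.
- have -> : p + k y * h - (p + k x * g) = k y * (h - g) + (y - x) * p * g.
    by rewrite /k; ring.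
  have B1 : `|e| / 2 * (N%:R * v * (y - x)) <= `|k y * (h - g)|.
    rewrite normrM; apply: ler_pM.
    + by rewrite divr_ge0// ltW.
    + by rewrite mulr_ge0// mulr_ge0.
    + exact: kge.
    + by apply: le_trans h3 _; exact: ler_norm.
  have B2 : `|(y - x) * p * g| <= (y - x) * `|p| * (2 * v).
    rewrite !normrM (ger0_norm t0) (ger0_norm g0) ler_wpM2l ?mulr_ge0//.
    by lra.
  have B3 : (2 * `|p| + 1) * (v * (y - x)) <= `|e| * N%:R / 2 * (v * (y - x)).
    by rewrite ler_wpM2r// mulr_ge0.
  have B4 : 1 * (y - x) <= v * (y - x) by rewrite ler_wpM2r.
  have := lerB_normD (k y * (h - g)) ((y - x) * p * g).
  have BE : `|e| / 2 * (N%:R * v * (y - x)) = `|e| * N%:R / 2 * (v * (y - x)) by ring.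
  rewrite BE in B1.
  by lra.
- have C1 : `|e| / 2 * v <= `|k x * g|.
    rewrite normrM (ger0_norm g0); apply: ler_pM.
    + by rewrite divr_ge0// ltW.
    + by [].
    + exact: kge.
    + by lra.
  rewrite (addrC p); have := lerB_normD (k x * g) p.
  by have := ler_norm rad; lra.
Qed.

End Cylinder.

(** * Jumps far away from the origin *)

Lemma Rintegral_sum_ord d (T : measurableType d) (R : realType)
    (P : probability T R) (f : nat -> T -> R) n :
  (forall k, P.-integrable setT (EFin \o f k)) ->
  P.-integrable setT (EFin \o (fun w => \sum_(k < n) f k w)) /\
  \int[P]_w (\sum_(k < n) f k w) = \sum_(k < n) \int[P]_w f k w.
Proof.
move=> fi; elim: n => [|n [IHi IHe]].
  split.
    apply: (@bounded_integrable _ _ _ _ _ 0) => [|w]; last by rewrite big_ord0 normr0.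
    by rewrite (_ : (fun _ => _) = cst 0)//; apply/funext => w; rewrite big_ord0.
  by under eq_Rintegral do rewrite big_ord0; rewrite Rintegral_cst// mul0r big_ord0.
have e : (fun w => \sum_(k < n.+1) f k w) = (fun w => \sum_(k < n) f k w + f n w).
  by apply/funext => w; rewrite big_ord_recr.
split; first by rewrite e; exact: (integrableD measurableT IHi (fi n)).
by rewrite e RintegralD// IHe big_ord_recr.
Qed.

Lemma sum_bool_le1 n (p : 'I_n -> bool) :
  (forall k k' : 'I_n, (k < k')%N -> p k -> p k' -> False) -> (\sum_(k < n) p k <= 1)%N.
Proof.
move=> inj; have [/existsP[k0 pk0]|/existsPn np] := boolP [exists k, p k].
  rewrite (bigD1 k0)//= big1 ?addn0 ?leq_b1// => k kk0.
  have [pk|//] := boolP (p k).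
  by case: (ltngtP k k0) => [/inj /(_ pk pk0)|/inj /(_ pk0 pk)|/val_inj /eqP]//;
    rewrite (negPf kk0).
by rewrite big1// => k _; rewrite (negPf (np k)).
Qed.

Section Jump.
Context d (T : measurableType d) (R : realType) (P : probability T R).
Variables (X : R -> T -> R) (a z : R).
Hypothesis mX : forall x, a <= x <= z -> measurable_fun setT (X x).
Hypothesis X_cont : forall (f : R -> R) (M dlt : R), continuous f ->
  (forall t, `|f t| <= M) -> 0 < dlt ->
  exists2 eta, 0 < eta <= z - a & forall x, a <= x <= a + eta ->
    `|\int[P]_w f (X x w) - \int[P]_w f (X a w)| <= dlt.
Hypothesis X_conc : exists r K : R, [/\ 0 < r < 2^-1, 0 < K &
  forall dlt, 0 < dlt -> exists n0 : nat, forall n, (n0 <= n)%N ->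
    exists (Y : seq R) (B : set T), [/\ size Y = (2 ^ n)%N, measurable B,
      (P (~` B) <= dlt%:E)%E &
      forall w, B w -> exists2 y, y \in Y & `|X a w - y| <= K * r ^+ n]].
Hypothesis X_spread : forall rad : R, exists (A : set T) (c eta : R),
  [/\ measurable A, 0 < c, (c%:E <= P A)%E, 0 < eta <= z - a &
  forall w x y, A w -> a <= x <= y -> y <= a + eta ->
    y - x <= `|X y w - X x w| /\ rad <= `|X x w|].

Let Xint (f : R -> R) x : smooth f -> (forall t, 0 <= f t <= 1) -> a <= x <= z ->
  P.-integrable setT (EFin \o (fun w => f (X x w))).
Proof.
move=> sf f01 xz; apply: (@bounded_integrable _ _ _ _ _ 1).
  apply: (measurableT_comp (f := f)); last exact: mX.
  by apply: continuous_measurable_fun; exact: smooth_continuous.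
by move=> w; have /andP[h0 h1] := f01 (X x w); rewrite ger0_norm.
Qed.

Let indint (A : set T) : measurable A ->
  P.-integrable setT (EFin \o (\1_A : T -> R)).
Proof.
move=> mA; apply: (@bounded_integrable _ _ _ _ _ 1) => [|w].
  exact: measurable_indic.
by rewrite indicE; case: (_ \in _); rewrite ?normr1 ?normr0.
Qed.

Let Rintegral_indic (A : set T) : measurable A -> \int[P]_w \1_A w = fine (P A).
Proof. by move=> mA; rewrite /Rintegral integral_indic ?setIT. Qed.

Section Bumps.
Variables (Y : seq R) (l kap : R).
Hypotheses (l0 : 0 < l) (kap0 : 0 < kap).

Definition bumps (t : R) : R := \sum_(y <- Y) flat 0 (l ^+ 2 - (t - y) ^+ 2).

(** A smooth substitute for the indicator of the l-neighbourhood of [Y]: the outer [flat] caps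
    overlapping bumps at 1, and a large kap brings the value near 1 well inside. *)
Definition cover (t : R) : R := flat 0 (bumps t * kap).

Lemma smooth_cover : smooth cover.
Proof.
apply: smooth_comp; first exact: smooth_flat.
apply: smoothM; last exact: smooth_cst.
apply: smooth_sum => y; apply: (@smooth_comp _ (flat 0)); first exact: smooth_flat.
apply: smoothB; first exact: smooth_cst.
under eq_fun do rewrite expr2.
by apply: smoothM; apply: smoothB; [exact: smooth_id|exact: smooth_cst|
  exact: smooth_id|exact: smooth_cst].
Qed.

Lemma cover01 t : 0 <= cover t <= 1.
Proof. by rewrite flat_ge0 flat_le1. Qed.

Lemma bumps_ge y t (s : R) : y \in Y -> `|t - y| <= s -> 0 <= s ->
  flat 0 (l ^+ 2 - s ^+ 2) <= bumps t.
Proof.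
move=> yY ts s0; rewrite /bumps (big_rem y)//= ler_wpDr//.
  by apply: sumr_ge0 => *; exact: flat_ge0.
apply: le_flat; rewrite lerD2l lerN2 -[(t - y) ^+ 2]real_normK ?num_real//.
by rewrite lerXn2r// nnegrE.
Qed.

(** A count with multiplicity, unlike an indicator, can be summed over the grid before being summed
    over [Y]. *)
Lemma cover_le_count t : cover t <= (\sum_(y <- Y) (`|t - y| < l)%R)%N%:R.
Proof.
have [/hasP[y yY ty]|/hasPn H] := boolP (has (fun y => `|t - y| < l) Y).
  apply: (le_trans (flat_le1 _)); rewrite (big_rem y)//= ty natrD lerDl.
  exact: ler0n.
rewrite /cover (_ : bumps t = 0) ?mul0r ?flat_eq0//.
rewrite /bumps big_seq big1// => y /H; rewrite -leNgt => lt.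
apply: flat_eq0; rewrite subr_le0 -[(t - y) ^+ 2]real_normK ?num_real//.
by rewrite lerXn2r// ?nnegrE// ltW.
Qed.

End Bumps.

(** The test function is f = chi U, with chi a fixed cut-off beyond rad and U a cover of the
    intervals. Only U depends on eta, so c can be read off from chi and P(A). *)
Lemma jump (rad : R) : 0 <= rad -> exists2 c, 0 < c & forall eta, 0 < eta ->
  exists (x : R) (f : R -> R), [/\ a < x <= a + eta, x <= z, smooth f,
    (forall t, 0 <= f t <= 1) /\ (forall t, `|t| <= rad -> f t = 0) &
    c <= `|\int[P]_w f (X x w) - \int[P]_w f (X a w)| ].
Proof.
(* The budget: passing from chi to f at a costs D/8, moving chi from a to x costs D/8, and the
   chosen grid point gains D/2. *)
have arith (p q u v D : R) : p - 2 * (D / 16) <= q -> u <= v - D / 2 ->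
  v - p <= D / 8 -> D / 4 <= q - u by lra.
move=> rad0.
have [A [cA [eta1 [mA cA0 cPA /andP[eta10 eta1z] HA]]]] := X_spread (rad + 1).
pose chi (t : R) : R := flat 0 (t ^+ 2 - rad ^+ 2).
have schi : smooth chi.
  apply: (@smooth_comp _ (flat 0)); first exact: smooth_flat.
  apply: smoothD; last exact: smooth_cst.
  by under eq_fun do rewrite expr2; apply: smoothM; exact: smooth_id.
have chi01 t : 0 <= chi t <= 1 by rewrite flat_ge0 flat_le1.
have chi_in t : `|t| <= rad -> chi t = 0.
  move=> tr; apply: flat_eq0; rewrite subr_le0 -[t ^+ 2]real_normK ?num_real//.
  by rewrite lerXn2r// nnegrE.
pose chi0 : R := flat 0 1.
have chi00 : 0 < chi0 by exact: flat_gt0.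
have chi_out t : rad + 1 <= `|t| -> chi0 <= chi t.
  move=> tr; apply: le_flat; rewrite -[t ^+ 2]real_normK ?num_real//.
  have : (rad + 1) ^+ 2 <= `|t| ^+ 2 by rewrite lerXn2r// nnegrE// addr_ge0.
  by rewrite sqrrD; lra.
pose Dl := chi0 * cA.
have Dl0 : 0 < Dl by rewrite mulr_gt0.
exists (Dl / 4); first by rewrite divr_gt0.
move=> eta eta0.
have Dl8 : 0 < Dl / 8 by rewrite divr_gt0.
have chiM t : `|chi t| <= 1 by have /andP[h0 h1] := chi01 t; rewrite ger0_norm.
have [eta2 /andP[eta20 eta2z] Heta2] :=
  X_cont (smooth_continuous schi) chiM Dl8.
pose et := Num.min eta (Num.min eta1 eta2).
have et0 : 0 < et by rewrite !lt_min eta0 eta10.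
have ete : et <= eta by rewrite ge_min lexx.
have ete1 : et <= eta1 by rewrite !ge_min lexx orbT.
have ete2 : et <= eta2 by rewrite !ge_min lexx !orbT.
have [r [K [/andP[r0 rh] K0 Hconc]]] := X_conc.
pose dlt := Dl / 16.
have dlt0 : 0 < dlt by rewrite divr_gt0.
have [n0 Hn0] := Hconc dlt dlt0.
(* 2^(n+1) grid points with mesh 4 K r^n span 8 K (2 r)^n, and r < 1/2 makes them fit close to a. *)
have [n1 Hn1] : exists n1, forall n, (n1 <= n)%N -> 8 * K * (2 * r) ^+ n <= et.
  have c2r : 8 * K * (2 * r) ^+ n @[n --> \oo] --> (0 : R).
    rewrite -(mulr0 (8 * K)); apply: cvgMl_tmp; apply: cvg_expr.
    by rewrite ger0_norm ?mulr_ge0 ?(ltW r0)//; lra.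
  have /cvgr0_norm_le /(_ _ et0) [n1 _ H] := c2r.
  by exists n1 => n /H; apply: le_trans; exact: ler_norm.
pose n := maxn n0 n1.
have [Y [B [sY mB PB HB]]] := Hn0 n (leq_maxl _ _).
have etn := Hn1 n (leq_maxr _ _).
pose l := 2 * K * r ^+ n.
have rn0 : 0 < r ^+ n by rewrite exprn_gt0.
have l0 : 0 < l by rewrite !mulr_gt0.
have [y0 y00 Hy0] := flat_near1 dlt0.
pose s0 := flat 0 (l ^+ 2 - (l / 2) ^+ 2).
have s00 : 0 < s0.
  apply: flat_gt0; have -> : l ^+ 2 - (l / 2) ^+ 2 = 3 / 4 * l ^+ 2 by field.
  by rewrite mulr_gt0// exprn_gt0.
(* [s0] is the height of one bump at distance l/2 = K r^n; the scaling lifts it to [y0], where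
   [flat] is at least 1 - dlt. *)
pose kap := y0 / s0.
have kap0 : 0 < kap by rewrite divr_gt0.
pose U := cover Y l kap.
have sU : smooth U by exact: smooth_cover.
have U01 t : 0 <= U t <= 1 by exact: cover01.
have UB w : B w -> 1 - dlt <= U (X a w).
  move=> /HB[y yY ya]; apply: (le_trans Hy0); apply: le_flat.
  have l2 : l / 2 = K * r ^+ n by rewrite /l; field.
  rewrite -ler_pdivrMr// /kap invf_div mulrCA divff ?gt_eqF// mulr1.
  by apply: bumps_ge yY _ _; rewrite l2// mulr_ge0// ltW.
pose f t := chi t * U t.
have sf : smooth f by exact: smoothM.
have f01 t : 0 <= f t <= 1.
  have /andP[c0 c1] := chi01 t; have /andP[u0 u1] := U01 t.
  by rewrite /f mulr_ge0//= mulr_ile1.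
have fle t : f t <= chi t.
  have /andP[c0 c1] := chi01 t; have /andP[u0 u1] := U01 t.
  by rewrite /f ler_piMr.
have za : a <= z by rewrite -subr_ge0 (le_trans (ltW eta10)).
have aaz : a <= a <= z by rewrite lexx.
have Ea : \int[P]_w chi (X a w) - 2 * dlt <= \int[P]_w f (X a w).
  have ifa := Xint sf f01 aaz.
  have ica := Xint schi chi01 aaz.
  have mCB : measurable (~` B) by exact: measurableC.
  have iB := indint mCB.
  have iD : P.-integrable setT (EFin \o (fun w => f (X a w) + \1_(~` B) w)).
    exact: (integrableD measurableT ifa iB).
  have iC : P.-integrable setT (EFin \o cst dlt) by exact: finite_measure_integrable_cst.
  have : \int[P]_w chi (X a w) <= \int[P]_w (f (X a w) + \1_(~` B) w + dlt).
    apply: le_Rintegral => //; first exact: (integrableD measurableT iD iC).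
    move=> w _; have /andP[c0 c1] := chi01 (X a w).
    have /andP[u0 u1] := U01 (X a w).
    rewrite indicE; have [Bw|Bw] := pselect (B w).
      rewrite memNset/= ?addr0; last by move=> /(_ Bw).
      have h : chi (X a w) * (1 - dlt) <= f (X a w) by rewrite ler_wpM2l// UB.
      have : chi (X a w) * dlt <= 1 * dlt by rewrite ler_wpM2r// ltW.
      by lra.
    rewrite mem_set//=.
    by have /andP[h _] := f01 (X a w); lra.
  rewrite RintegralD// RintegralD// Rintegral_indic// Rintegral_cst//=.
  rewrite probability_setT/= mulr1.
  have : fine (P (~` B)) <= dlt.
    by rewrite -lee_fin fineK// fin_num_measure.
  by lra.
(* On A the variables at two points of a grid of mesh 2 l are 2 l apart, so each
   of the 2^n intervals contains at most one of the 2^(n+1) grid values. *)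
pose h := 2 * l.
have [N ND] : exists N, N = (2 ^ n.+1)%N by exists (2 ^ n.+1)%N.
have NE : N%:R = 2 * 2 ^+ n :> R by rewrite ND natrX exprS.
have NhE : N%:R * h = 8 * K * (2 * r) ^+ n by rewrite NE /h /l exprMn; ring.
have h0 : 0 < h by rewrite mulr_gt0.
pose x (k : nat) := a + k.+1%:R * h.
have xa k : a < x k by rewrite ltrDl mulr_gt0.
have xe k : (k < N)%N -> x k <= a + et.
  move=> kN; rewrite lerD2l; apply: le_trans etn; rewrite -NhE ler_pM2r//.
  by rewrite ler_nat.
have xz k : (k < N)%N -> a <= x k <= z.
  by move=> kN; rewrite ltW//=; have := xe k kN; lra.
have count w : A w -> \sum_(k < N) U (X (x k) w) <= 2 ^+ n.
  move=> Aw.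
  have : \sum_(k < N) U (X (x k) w) <=
      \sum_(k < N) (\sum_(y <- Y) (`|X (x k) w - y| < l)%R)%N%:R.
    by apply: ler_sum => k _; exact: cover_le_count.
  move=> /le_trans; apply; rewrite -natr_sum exchange_big/= -natrX ler_nat -sY.
  rewrite -sum1_size; apply: leq_sum => y _; apply: sum_bool_le1 => k k' kk' p1 p2.
  have xk : a <= x k <= x k'.
    by rewrite ltW//= lerD2l ler_pM2r// ler_nat ltnW.
  have xk' : x k' <= a + eta1 by rewrite (le_trans (xe _ (ltn_ord k')))// lerD2l.
  have [sp _] := HA w (x k) (x k') Aw xk xk'.
  have : h <= x k' - x k.
    rewrite /x opprD addrACA subrr add0r -mulrBl ler_peMl ?(ltW h0)//.
    by rewrite lerBrDr nat1r ler_nat.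
  have := ler_distD y (X (x k') w) (X (x k) w).
  by rewrite (distrC y); rewrite /h; lra.
(* Averaging: on A the 2^(n+1) values 1 - U sum to at least 2^n and chi >= [chi0], so the grid mean
   of the expectations of chi - f is at least [chi0] P(A) / 2 >= Dl / 2. *)
have [k [kN Hk]] : exists k, (k < N)%N /\
    \int[P]_w f (X (x k) w) <= \int[P]_w chi (X (x k) w) - Dl / 2.
  apply: contrapT => Hno.
  have N0 : (0 < N)%N by rewrite ND expn_gt0.
  (* The value 0 for k >= N makes the family integrable at every index, even where x k leaves
     [a, z]. *)
  have ig k : P.-integrable setT (EFin \o (fun w => if (k < N)%N then
     chi (X (x k) w) - f (X (x k) w) else 0)).
    have [kN|kN] := ltnP k N; last exact: finite_measure_integrable_cst.
    exact: (integrableB measurableT (Xint schi chi01 (xz k kN))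
      (Xint sf f01 (xz k kN))).
  have [iS eS] := Rintegral_sum_ord N ig.
  have up : \int[P]_w (\sum_(k < N) (if (k < N)%N then
     chi (X (x k) w) - f (X (x k) w) else 0)) < N%:R * (Dl / 2).
    rewrite eS mulr_natl -[X in _ *+ X](card_ord N) -sumr_const.
    apply: ltr_sum; first by apply/hasP; exists (Ordinal (N0 : 0 < N)%N); rewrite ?mem_index_enum.
    move=> k _; rewrite ltn_ord RintegralB//; try (apply: Xint => //; exact: xz).
    by rewrite ltNge; apply/negP => hk; apply: Hno; exists k; split;
      [exact: ltn_ord|rewrite lerBrDl -lerBrDr].
  have iA : P.-integrable setT (EFin \o (fun w => chi0 * 2 ^+ n * \1_A w)).
    apply: (@bounded_integrable _ _ _ _ _ (chi0 * 2 ^+ n)).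
      by apply: measurable_funM => //; exact: measurable_indic.
    move=> w; rewrite indicE; case: (_ \in _) => /=.
      by rewrite mulr1 ger0_norm// mulr_ge0 ?exprn_ge0// ltW.
    by rewrite mulr0 normr0 mulr_ge0 ?exprn_ge0// ltW.
  have lo : \int[P]_w (chi0 * 2 ^+ n * \1_A w) <= \int[P]_w (\sum_(k < N) (if (k < N)%N then
     chi (X (x k) w) - f (X (x k) w) else 0)).
    apply: le_Rintegral => // w _; rewrite indicE.
    have [Aw|Aw] := pselect (A w); last first.
      rewrite memNset// mulr0; apply: sumr_ge0 => k _; rewrite ltn_ord subr_ge0.
      exact: fle.
    rewrite mem_set// mulr1.
    have ge : \sum_(k < N) (chi0 * (1 - U (X (x k) w))) <= \sum_(k < N) (if (k < N)%N then
       chi (X (x k) w) - f (X (x k) w) else 0).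
      apply: ler_sum => k _; rewrite ltn_ord /f.
      rewrite (_ : chi _ - _ = chi (X (x k) w) * (1 - U (X (x k) w))); last by ring.
      have /andP[u0 u1] := U01 (X (x k) w).
      apply: ler_wpM2r; first by rewrite subr_ge0.
      apply: chi_out.
      have xk : a <= x k <= x k by rewrite lexx ltW.
      have xk' : x k <= a + eta1 by rewrite (le_trans (xe _ (ltn_ord k)))// lerD2l.
      by have [] := HA w (x k) (x k) Aw xk xk'.
    apply: le_trans ge; rewrite -mulr_sumr sumrB sumr_const card_ord -mulr_natr mul1r NE.
    by rewrite ler_pM2l//; have := count w Aw; lra.
  have := le_lt_trans lo up; rewrite RintegralZl//; last exact: indint.
  rewrite Rintegral_indic// NE.
  have : cA <= fine (P A) by rewrite -lee_fin fineK// fin_num_measure.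
  move=> cle; have : chi0 * 2 ^+ n * cA <= chi0 * 2 ^+ n * fine (P A).
    by rewrite ler_wpM2l// mulr_ge0 ?exprn_ge0// ltW.
  by rewrite /Dl; lra.
exists (x k), f; split.
- by rewrite xa/= (le_trans (xe k kN))// lerD2l.
- by have /andP[] := xz k kN.
- exact: sf.
- by split=> // t tr; rewrite /f chi_in// mul0r.
have xk2 : a <= x k <= a + eta2 by rewrite ltW//= (le_trans (xe k kN))// lerD2l.
have := Heta2 (x k) xk2; rewrite ler_norml => /andP[_ H2].
rewrite distrC; apply: le_trans (ler_norm _).
exact: arith Ea Hk H2.
Qed.

End Jump.

(** * Gliding hump *)

Section GlidingHump.
Context d (T : measurableType d) (R : realType) (P : probability T R).
Variables (X : R -> T -> R) (a z : R).
Hypothesis az : a < z.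
Hypothesis mX : forall x, a <= x <= z -> measurable_fun setT (X x).
Hypothesis X_cont : forall (f : R -> R) (M dlt : R), continuous f ->
  (forall t, `|f t| <= M) -> 0 < dlt ->
  exists2 eta, 0 < eta <= z - a & forall x, a <= x <= a + eta ->
    `|\int[P]_w f (X x w) - \int[P]_w f (X a w)| <= dlt.
Hypothesis X_tight : forall dlt : R, 0 < dlt -> exists r : nat,
  forall x (f : R -> R), a <= x <= z -> measurable_fun setT f ->
  (forall t, 0 <= f t <= 1) -> (forall t, `|t| <= r%:R -> f t = 0) ->
  \int[P]_w f (X x w) <= dlt.
Hypothesis X_jump : forall rad : R, 0 <= rad -> exists2 c, 0 < c &
  forall eta, 0 < eta ->
  exists (x : R) (f : R -> R), [/\ a < x <= a + eta, x <= z, smooth f,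
    (forall t, 0 <= f t <= 1) /\ (forall t, `|t| <= rad -> f t = 0) &
    c <= `|\int[P]_w f (X x w) - \int[P]_w f (X a w)| ].

Let E (f : R -> R) (x : R) := \int[P]_w f (X x w).

Let Xint (f : R -> R) M x : smooth f -> (forall t, 0 <= f t <= M) -> a <= x <= z ->
  P.-integrable setT (EFin \o (fun w => f (X x w))).
Proof.
move=> sf f01 xz; apply: (@bounded_integrable _ _ _ _ _ M).
  apply: (measurableT_comp (f := f)); last exact: mX.
  by apply: continuous_measurable_fun; exact: smooth_continuous.
by move=> w; have /andP[h0 h1] := f01 (X x w); rewrite ger0_norm.
Qed.

(** One stage: g is the sum of the earlier humps, (x, f) the new point and hump. Guarding by the
    conditions on g makes the relation total, so that choice gives a function to iterate. *)
Let jump_spec (c : R -> R) (rad : nat -> R) (mg : nat * (R -> R)) (xf : R * (R -> R)) :=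
  let: (m, g) := mg in let: (x, f) := xf in
  smooth g -> (forall t, 0 <= g t <= 2) ->
  [/\ a < x <= z, (x - a) * m.+1%:R <= 1,
      (x - a) * m.+1%:R <= 2^-1 ^+ m * c (rad m) / 2, smooth f &
   [/\ (forall t, 0 <= f t <= 1), (forall t, `|t| <= rad m -> f t = 0),
      c (rad m) <= `|E f x - E f a| &
      `|E g x - E g a| <= 2^-1 ^+ m * c (rad m) / 8]].

(** Let J = 2^-m c be the jump of the m-th weighted hump at its point x. Earlier humps vary by at
    most J/8, as x is chosen after them; later ones by at most J/8, as their supports are far out.
    What remains exceeds J/2 >= (m + 1) (x - a). *)
Lemma gliding_hump : exists phi : R -> R, [/\ smooth phi,
  (forall t, 0 <= phi t <= 2) &
  forall C eta, 0 < eta -> exists2 x, a < x <= z /\ x <= a + eta &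
    C * (x - a) < `|\int[P]_w phi (X x w) - \int[P]_w phi (X a w)|].
Proof.
have /choice[c Hc] : forall rad, exists c : R, 0 <= rad -> 0 < c /\
    forall eta, 0 < eta ->
    exists (x : R) (f : R -> R), [/\ a < x <= a + eta, x <= z, smooth f,
      (forall t, 0 <= f t <= 1) /\ (forall t, `|t| <= rad -> f t = 0) &
      c <= `|E f x - E f a| ].
  move=> rad; have [rad0|radN] := leP 0 rad.
    by have [c c0 H] := X_jump rad0; exists c.
  by exists 0.
have /choice[rt Hrt] : forall dlt : R, exists rt : nat, 0 < dlt ->
    forall x (f : R -> R), a <= x <= z -> measurable_fun setT f ->
    (forall t, 0 <= f t <= 1) -> (forall t, `|t| <= rt%:R -> f t = 0) ->
    E f x <= dlt.
  move=> dlt; have [dlt0|dltN] := ltP 0 dlt.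
    by have [r Hr] := X_tight dlt0; exists r.
  by exists 0%N.
(* The radii can be fixed in advance, because c depends on the radius alone. The tightness radius
   makes later humps negligible; the successor forces the radii to infinity. *)
pose radn := fix radn (m : nat) : nat := if m is m'.+1 then
  (radn m' + (rt (c (radn m')%:R / 8)).+1)%N else 0%N.
pose rad m : R := (radn m)%:R.
have rad0 m : 0 <= rad m by rewrite ler0n.
have c0 m : 0 < c (rad m) by have [] := Hc _ (rad0 m).
have radS m : rad m <= rad m.+1 by rewrite ler_nat /= leq_addr.
have rad_mono m n : (m <= n)%N -> rad m <= rad n.
  by apply: (homo_leq (@lexx _ R) (@le_trans _ R)).
have rad_ge m : m%:R <= rad m.
  rewrite ler_nat; elim: m => [//|m IH] /=.
  by rewrite addnS ltnS (leq_trans IH)// leq_addr.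
have rad_rt m : (rt (c (rad m) / 8))%:R <= rad m.+1.
  by rewrite ler_nat /= addnS leqW// leq_addl.
have p2 m : 0 < 2^-1 ^+ m :> R by rewrite exprn_gt0// invr_gt0.
have /choice[F HF] : forall mg, exists xf, jump_spec c rad mg xf.
  move=> [m g]; rewrite /jump_spec.
  have [[sg g2]|nsg] := pselect (smooth g /\ forall t, 0 <= g t <= 2); last first.
    by exists (a, g) => sg g2; case: nsg.
  have cm0 : 0 < 2^-1 ^+ m * c (rad m) by rewrite mulr_gt0.
  have cm8 : 0 < 2^-1 ^+ m * c (rad m) / 8 by rewrite divr_gt0.
  have gM t : `|g t| <= 2 by have /andP[h0 h1] := g2 t; rewrite ger0_norm.
  have [eta1 /andP[eta10 eta1z] Heta1] := X_cont (smooth_continuous sg) gM cm8.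
  pose eta := Num.min eta1 (Num.min (m.+1%:R^-1) (2^-1 ^+ m * c (rad m) / 2 / m.+1%:R)).
  have eta0 : 0 < eta by rewrite !lt_min eta10 invr_gt0 ltr0Sn /= !divr_gt0.
  have [_ /(_ eta eta0)] := Hc (rad m) (rad0 m).
  move=> [x [f [/andP[ax xe] xz sf [f01 f0] cf]]]; exists (x, f) => _ _.
  have xae : x - a <= eta by rewrite lerBlDl.
  split=> //.
  - by rewrite ax.
  - by rewrite -ler_pdivlMr// mul1r (le_trans xae)// /eta !ge_min lexx /= orbT.
  - by rewrite -ler_pdivlMr// (le_trans xae)// /eta !ge_min lexx !orbT.
  split=> //; apply: Heta1; apply/andP; split; first exact: ltW.
  by rewrite -lerBlDl (le_trans xae)// /eta ge_min lexx.
pose psi := fix psi (m : nat) : R -> R := if m is m'.+1 then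
  (fun t => psi m' t + 2^-1 ^+ m' * (F (m', psi m')).2 t) else (fun=> 0).
pose ph m := (F (m, psi m)).2.
pose xs m := (F (m, psi m)).1.
have psiS m t : psi m.+1 t = psi m t + 2^-1 ^+ m * ph m t by [].
have inv m : smooth (psi m) /\ forall t, 0 <= psi m t <= 2 - 2 * 2^-1 ^+ m.
  elim: m => [|m [sm bm]]; first by split; [exact: smooth_cst|move=> t; rewrite expr0 mulr1 subrr lexx].
  have b2 t : 0 <= psi m t <= 2.
    by have /andP[-> /= h] := bm t; apply: (le_trans h); have := p2 m; lra.
  have := HF (m, psi m); rewrite /jump_spec -/(ph m); case EF : (F _) => [x f].
  move=> /(_ sm b2) [_ _ _ sf [f01 _ _ _]].
  have phE : ph m = f by rewrite /ph EF.
  split.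
    have -> : psi m.+1 = fun t => psi m t + 2^-1 ^+ m * ph m t by [].
    rewrite phE; apply: smoothD; first exact: sm.
    by apply: smoothM; [exact: smooth_cst|exact: sf].
  move=> t; rewrite psiS phE exprS.
  have /andP[h0 h1] := bm t; have /andP[f0 f1] := f01 t.
  have k0 : 0 <= 2^-1 ^+ m * f t by rewrite mulr_ge0// ltW.
  have k1 : 2^-1 ^+ m * f t <= 2^-1 ^+ m * 1 by rewrite ler_wpM2l// ltW.
  by apply/andP; split; lra.
have spsi m : smooth (psi m) by have [] := inv m.
have psi2 m t : 0 <= psi m t <= 2.
  by have [_ /(_ t) /andP[-> h]] := inv m; apply: (le_trans h); have := p2 m; lra.
have step m : [/\ a < xs m <= z, (xs m - a) * m.+1%:R <= 1,
      (xs m - a) * m.+1%:R <= 2^-1 ^+ m * c (rad m) / 2, smooth (ph m) &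
   [/\ (forall t, 0 <= ph m t <= 1), (forall t, `|t| <= rad m -> ph m t = 0),
      c (rad m) <= `|E (ph m) (xs m) - E (ph m) a| &
      `|E (psi m) (xs m) - E (psi m) a| <= 2^-1 ^+ m * c (rad m) / 8]].
  have := HF (m, psi m); rewrite /jump_spec /xs /ph.
  by case: (F _) => x f; apply.
have ph01 m t : 0 <= ph m t <= 1 by have [_ _ _ _ [+ _ _ _]] := step m.
have psi_nd n m t : (n <= m)%N -> psi n t <= psi m t.
  apply: (homo_leq (@lexx _ R) (@le_trans _ R) (f := fun m => psi m t)) => k.
  by rewrite psiS lerDl mulr_ge0 ?(ltW (p2 k))//; case/andP: (ph01 k t).
(* With the mass of all remaining weights added, the partial sums become nonincreasing; this bounds
   every tail. *)
have psi_ni n m t : (n <= m)%N -> psi m t + 2 * 2^-1 ^+ m <= psi n t + 2 * 2^-1 ^+ n.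
  elim: m => [|m IH]; first by rewrite leqn0 => /eqP ->.
  rewrite leq_eqVlt => /predU1P[->//|]; rewrite ltnS => /IH; apply: le_trans.
  rewrite psiS exprS; have /andP[_ f1] := ph01 m t.
  have k1 : 2^-1 ^+ m * ph m t <= 2^-1 ^+ m * 1 by rewrite ler_wpM2l// ltW.
  by lra.
have psi_stab n m t : (n <= m)%N -> `|t| <= rad n -> psi m t = psi n t.
  move=> nm tn; elim: m nm => [|m IH]; first by rewrite leqn0 => /eqP ->.
  rewrite leq_eqVlt => /predU1P[->//|]; rewrite ltnS => nm.
  rewrite psiS IH//; have [_ _ _ _ [_ -> //]] := step m; first by rewrite mulr0 addr0.
  by rewrite (le_trans tn)// rad_mono.
(* The sum is locally finite since the m-th hump vanishes on [-rad m, rad m]. *)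
pose phi t := psi (Num.truncn `|t|).+1 t.
have phiE n t : `|t| <= rad n -> phi t = psi n t.
  move=> tn; rewrite /phi; set m := _.+1.
  have tm : `|t| <= rad m by rewrite (le_trans (ltW (truncnS_gt _)))// rad_ge.
  have [nm|mn] := leqP n m; first exact: psi_stab.
  by apply/esym; apply: psi_stab => //; exact: ltnW.
have phi2 t : 0 <= phi t <= 2 by exact: psi2.
have sphi : smooth phi.
  apply: smooth_locally => x; pose n := (Num.truncn `|x|).+1.
  exists (psi n), [set t | `|t| < n%:R]; split => //.
  - rewrite (_ : [set t | _] = ball (0 : R) n%:R); first exact: ball_open.
    by apply/seteqP; split => t; rewrite /ball/= sub0r normrN.
  - exact: truncnS_gt.
  - move=> t; rewrite inE => tn; apply: phiE.
    by apply: le_trans (rad_ge n); exact: ltW.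
exists phi; split => // C eta eta0.
pose m := (Num.truncn (Num.max C eta^-1)).+1.
have mC : C < m%:R by rewrite (le_lt_trans _ (truncnS_gt _))// le_max lexx.
have meta : eta^-1 < m%:R by rewrite (le_lt_trans _ (truncnS_gt _))// le_max lexx orbT.
have [/andP[axm xmz] xm1 xmc sph [_ _ cph cpsi]] := step m.
have xa0 : 0 < xs m - a by rewrite subr_gt0.
have mS : m%:R < m.+1%:R :> R by rewrite ltr_nat.
exists (xs m).
  split; first by rewrite axm.
  rewrite -lerBlDl -(invrK eta) -[leRHS]mul1r ler_pdivlMr ?invr_gt0//.
  by apply: le_trans xm1; rewrite ler_pM2l// ltW// (lt_trans meta).
pose tail t := phi t - psi m.+1 t.
have stail : smooth tail := smoothB sphi (spsi m.+1).
have tailb t : 0 <= tail t <= 2^-1 ^+ m.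
  rewrite /tail /phi; set k := _.+1; set j := maxn k m.+1.
  have -> : psi k t = psi j t.
    apply/esym; apply: psi_stab; first exact: leq_maxl.
    by rewrite (le_trans (ltW (truncnS_gt _)))// rad_ge.
  rewrite subr_ge0 psi_nd ?leq_maxr//= lerBlDl.
  have := psi_ni m.+1 j t (leq_maxr _ _).
  rewrite (exprS _ m) mulrA divff// mul1r; apply: le_trans.
  by rewrite lerDl mulr_ge0// ltW.
have tail0 t : `|t| <= rad m.+1 -> tail t = 0.
  by move=> tr; rewrite /tail (phiE m.+1)// subrr.
have Etail x : a <= x <= z -> 0 <= E tail x <= 2^-1 ^+ m * c (rad m) / 8.
  move=> xz; apply/andP; split.
    by apply: Rintegral_ge0 => w _; case/andP: (tailb (X x w)).
  (* Rescaled to [0, 1] for tightness; scaling back gains the factor 2^-m that the comparison with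
     the m-th jump needs. *)
  pose g t := 2 ^+ m * tail t.
  have mg2 : 2 ^+ m * 2^-1 ^+ m = 1 :> R by rewrite -exprMn divff// expr1n.
  have sg : smooth g.
    by apply: smoothM; [exact: smooth_cst|exact: stail].
  have g01 t : 0 <= g t <= 1.
    have /andP[h0 h1] := tailb t; rewrite mulr_ge0 ?exprn_ge0//=.
    by rewrite -mg2 ler_wpM2l// exprn_ge0.
  have -> : E tail x = 2^-1 ^+ m * E g x.
    rewrite /E -RintegralZl//; last exact: (Xint sg g01).
    by apply: eq_Rintegral => w _; rewrite /g mulrA -exprMn mulVf// expr1n mul1r.
  rewrite -mulrA ler_wpM2l ?(ltW (p2 m))//; apply: Hrt => //.
  - by rewrite divr_gt0.
  - by apply: continuous_measurable_fun; exact: smooth_continuous.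
  - by move=> t tr; rewrite /g tail0 ?mulr0// (le_trans tr)// rad_rt.
have Ephi x : a <= x <= z -> E phi x = E (psi m) x + 2^-1 ^+ m * E (ph m) x + E tail x.
  move=> xz; have i1 := Xint (spsi m) (psi2 m) xz.
  have i2 := Xint sph (ph01 m) xz; have i3 := Xint stail tailb xz.
  have i2' : P.-integrable setT (EFin \o (fun w => 2^-1 ^+ m * ph m (X x w))).
    exact: (integrableZl measurableT (2^-1 ^+ m) i2).
  rewrite /E -RintegralZl// -RintegralD// -RintegralD//.
    by apply: eq_Rintegral => w _; rewrite /tail psiS; ring.
  exact: (integrableD measurableT i1 i2').
have aaz : a <= a <= z by rewrite lexx ltW.
have xaz : a <= xs m <= z by rewrite ltW.
have /andP[t1 t2] := Etail a aaz; have /andP[t3 t4] := Etail (xs m) xaz.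
rewrite -/(E phi (xs m)) -/(E phi a) (Ephi a aaz) (Ephi (xs m) xaz).
have cc : C * (xs m - a) < 2^-1 ^+ m * c (rad m) / 2.
  apply: lt_le_trans xmc; rewrite mulrC ltr_pM2l//; exact: lt_trans mS.
have main : 2^-1 ^+ m * c (rad m) <= `|2^-1 ^+ m * (E (ph m) (xs m) - E (ph m) a)|.
  by rewrite normrM gtr0_norm// ler_pM2l.
have e1 : E (psi m) (xs m) + 2^-1 ^+ m * E (ph m) (xs m) + E tail (xs m) -
   (E (psi m) a + 2^-1 ^+ m * E (ph m) a + E tail a) =
   2^-1 ^+ m * (E (ph m) (xs m) - E (ph m) a) +
   ((E (psi m) (xs m) - E (psi m) a) + (E tail (xs m) - E tail a)) by ring.
rewrite e1.
have n1 := lerB_normD (2^-1 ^+ m * (E (ph m) (xs m) - E (ph m) a))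
   ((E (psi m) (xs m) - E (psi m) a) + (E tail (xs m) - E tail a)).
have n2 := ler_normD (E (psi m) (xs m) - E (psi m) a) (E tail (xs m) - E tail a).
have n3 : `|E tail (xs m) - E tail a| <= 2^-1 ^+ m * c (rad m) / 8.
  by rewrite ler_norml; apply/andP; split; lra.
have cm0 : 0 < 2^-1 ^+ m * c (rad m) by rewrite mulr_gt0.
by lra.
Qed.

End GlidingHump.

(** * From jumps to non-differentiability *)

Lemma derivable_lipschitz_at (R : realType) (h : R -> R) :
  derivable h 0 1 -> exists C eta : R, 0 < eta /\
    forall e, 0 < e < eta -> `|h e - h 0| <= C * e.
Proof.
move=> /cvg_ex[L hL]; exists (`|L| + 1).
have /cvgr_dist_lt /(_ _ (@ltr01 R)) [eta /= eta0 Heta] := hL.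
exists eta; split => // e /andP[e0 ee].
have := Heta e; rewrite /= /ball/= sub0r normrN gtr0_norm// => /(_ ee (lt0r_neq0 e0)).
rewrite addr0 /GRing.scale/= mulr1 => H.
have : `|e^-1 * (h e - h 0)| <= `|L| + 1.
  have := lerB_dist (e^-1 * (h e - h 0)) L; rewrite distrC.
  by move: H => /ltW; lra.
rewrite normrM normfV (gtr0_norm e0) => K.
by rewrite mulrC -ler_pdivrMl.
Qed.

Unset Implicit Arguments.

Theorem theorem1p4 (R : realType) (d1 d2 l1 l2 : R)
    (hl1 : 0 < l1 < 1) (hl2 : 1 < l2) (hl12 : l1 * l2 < 4^-1)
    (hfix : d1 / (1 - l1) != d2 / (1 - l2)) :
  exists phi : R -> R,
    [/\ smooth phi,
        (exists M : R, forall x : R, `|phi x| <= M)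
      & ~ derivable
          (fun eps : R =>
             \int[stationary_measure d1 d2 (l1 + eps) l2]_x phi x) 0 1].
Proof.
have /andP[a0 a1] := hl1.
have b0 : 0 < l2 by exact: lt_trans hl2.
(* Midpoint of l1 and 1/l2: room to the right of l1 while z l2 < 1. *)
pose z := (l1 + l2^-1) / 2.
have ab : l1 < l2^-1 by rewrite -[l2^-1]mul1r ltr_pdivlMr//; lra.
have az : l1 < z by rewrite /z; lra.
have zb : z * l2 < 1.
  have -> : z * l2 = (l1 * l2 + 1) / 2 by rewrite /z; field; rewrite gt_eqF.
  by lra.
(* This number is (1 - l1) times the difference of the two fixed points. *)
have e0 : d1 - fixpt d2 l2 + l1 * fixpt d2 l2 != 0.
  apply: contraNneq hfix => /eqP; rewrite /fixpt => /eqP e.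
  rewrite -subr_eq0 -[X in X == _](_ : (d1 - d2 / (1 - l2) + l1 * (d2 / (1 - l2))) / (1 - l1) = _).
    by rewrite e mul0r.
  by field; rewrite !subr_eq0 (gt_eqF a1) (lt_eqF hl2).
have mi := @measurable_digit R; have mt := @measurable_shft R.
have cP := @coin_shift_coin R.
have mX x : l1 <= x <= z ->
    measurable_fun setT (statvar (@digit R) (@shft R) d1 d2 l2 z x).
  move=> /andP[ax xz]; apply: (measurable_statvar mi mt) => //.
  by rewrite xz (le_trans (ltW a0)).
have Xc := @expectation_continuous _ _ _ _ _ _ mi mt cP d1 d2 _ _ _ hl2 zb a0 az.
have Xt := @expectation_tight _ _ _ _ _ _ mi mt cP d1 d2 _ _ _ hl2 zb a0 az.
have Xj := jump mX Xc (concentration mi mt cP d1 d2 hl2 zb a0 az hl12)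
  (statvar_spread mi mt cP hl2 zb a0 az e0).
have [phi [sphi phi2 jmp]] := gliding_hump az mX Xc Xt Xj.
exists phi; split => //.
  by exists 2 => x; have /andP[p0 p1] := phi2 x; rewrite ger0_norm.
(* A derivative would force a Lipschitz bound to the right of 0, contradicted at a jump point; eta /
   2 keeps that point strictly inside the range of the bound. *)
move=> /derivable_lipschitz_at[C [eta [eta0 Hlip]]].
have [x [/andP[ax xz] xe]] := jmp C (eta / 2) (divr_gt0 eta0 (ltr0Sn R 1)).
have RE y : l1 <= y <= z -> \int[stationary_measure d1 d2 y l2]_t phi t =
    \int[coin R]_w phi (statvar (@digit R) (@shft R) d1 d2 l2 z y w).
  move=> /andP[ay yz].
  apply: (Rintegral_stationary_measure mi mt cP d1 d2 hl2 zb a0 az _ _ phi2).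
    by rewrite yz (lt_le_trans a0).
  exact: smooth_continuous.
have xl : 0 < x - l1 < eta by rewrite subr_gt0 ax /=; lra.
have xE : l1 + (x - l1) = x by rewrite addrC subrK.
have := Hlip _ xl; rewrite addr0 xE !RE ?lexx ?(ltW ax) ?(ltW az)//.
by rewrite leNgt => /negP.
Qed.
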